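(* Suppose $\sum_{n}\frac{|a_n|}{\lambda_n}<\infty$ and fix a compact interval $I=[\alpha_0,\alpha_1]\subset(0,1)$. Suppose that for some $m\in\mathbb{N}$, $m\ge1$, $$S_1=\cdots=S_{m-1}=0,\qquad S_m\ne0.$$ Assume also that $$c_m(\alpha)=\frac{(-1)^{m+1}}{\Gamma(1-m\alpha)}\ne0\qquad\text{for all }\alpha\in I$$ (equivalently, if $m\ge2$, the interval $I$ does not intersect $\{\frac1m,\frac2m,\ldots,\frac{m-1}{m}\}$). Then there exists $T_I>1$ such that, for every $t_0\ge T_I$, the map $I\ni\alpha\mapsto M_\alpha(t_0)$ is strictly monotone. More precisely, its monotonicity direction is determined by the constant sign of $-S_mc_m(\alpha)$ on $I$ (strictly increasing if this sign is positive, strictly decreasing if it is negative). Consequently, for every $t_0\ge T_I$ and every $d_0\in\mathbb{R}$, the equation $M_\alpha(t_0)=d_0$ has at most one solution $\alpha\in I$.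
   Context: Let $H$ be a real separable Hilbert space and $\mathcal{A}:\operatorname{Dom}(\mathcal{A})\subset H\to H$ a self-adjoint, strictly positive operator with compact resolvent, with eigenvalues counted with multiplicity $0<\lambda_1\le\lambda_2\le\cdots$ and an orthonormal eigenbasis $\{v_n\}$, $\mathcal{A}v_n=\lambda_nv_n$; in infinite dimensions $\lambda_n\to\infty$, and in finite dimensions the list of eigenvalues is finite and all spectral sums terminate accordingly. Let $\{a_n\}\subset\mathbb{R}$ be real coefficients. The resolvent moments are $S_k=\sum_{n}\frac{a_n}{\lambda_n^k}$, $k\ge1$. The scalar observation is $M_\alpha(t)=\sum_{n}a_nE_{\alpha,1}(-\lambda_nt^\alpha)$, $t>0$, $\alpha\in(0,1)$, where $E_{\alpha,1}(z)=\sum_{i\ge0}z^i/\Gamma(\alpha i+1)$ is the Mittag-Leffler function. The function $1/\Gamma$ is the entire reciprocal gamma function, vanishing at non-positive integers. *)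

(* Defs.v *)
From HB Require Import structures.
From mathcomp Require Import all_boot all_order all_algebra.
From mathcomp Require Import all_classical all_reals all_analysis.

Set Implicit Arguments.
Unset Strict Implicit.
Unset Printing Implicit Defensive.

Import Order.TTheory GRing.Theory Num.Theory numFieldNormedType.Exports.

Local Open Scope classical_set_scope.
Local Open Scope ring_scope.

Section SpectralSetting.
Context {R : realType} {H : completeNormedModType R}.

(* The norm (hence the topology and the completeness) of H is the one induced
   by the positive definite symmetric form ip. *)
Definition hilbert_inner_product (ip : {dot H for idfun}) : Prop :=
  forall x : H, ip x x = `|x| ^+ 2.

Definition separable_space : Prop :=
  exists2 S : set H, countable S & dense S.

(* An unbounded operator is a pair (dom, A); A is irrelevant outside dom. *)
Definition linear_on (dom : set H) (A : H -> H) : Prop :=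
  dom 0 /\
  forall (c : R) (x y : H), dom x -> dom y ->
    dom (c *: x + y) /\ A (c *: x + y) = c *: A x + A y.

(* The graph of the adjoint of A is the graph of A. *)
Definition self_adjoint (ip : {dot H for idfun}) (dom : set H) (A : H -> H) :
    Prop :=
  dense dom /\
  forall y z : H,
    (forall x, dom x -> ip (A x) y = ip x z) <-> (dom y /\ A y = z).

Definition strictly_positive (ip : {dot H for idfun}) (dom : set H)
    (A : H -> H) : Prop :=
  forall x, dom x -> x != 0 -> 0 < ip (A x) x.

Definition compact_operator (K : H -> H) : Prop :=
  compact (closure (K @` [set x : H | `|x| <= 1])).

(* K is the resolvent (A - z)^-1; it is linear as the inverse of a linear map,
   and bounded by compactness. *)
Definition compact_resolvent (dom : set H) (A : H -> H) : Prop :=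
  exists (z : R) (K : H -> H),
    [/\ forall y, dom (K y) /\ A (K y) - z *: K y = y,
        forall x, dom x -> K (A x - z *: x) = x
      & compact_operator K].

(* The eigenvalue list is indexed from 0 by N, which is the whole of nat if H
   is infinite dimensional and {0, ..., d - 1} if H has dimension d. The values
   of lambda and v outside N are irrelevant. *)
Record eigenbasis (ip : {dot H for idfun}) (dom : set H) (A : H -> H)
    (N : set nat) (lambda : nat -> R) (v : nat -> H) : Prop := {
  eigenbasis_index : N = setT \/ exists d, N = `I_d ;
  eigenbasis_gt0 : forall n, N n -> 0 < lambda n ;
  eigenbasis_le :
    forall n p, N n -> N p -> (n <= p)%N -> lambda n <= lambda p ;
  eigenbasis_cvgy : N = setT -> lambda n @[n --> \oo] --> +oo ;
  eigenbasis_dom : forall n, N n -> dom (v n) ;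
  eigenbasis_eigen : forall n, N n -> A (v n) = lambda n *: v n ;
  eigenbasis_orthonormal :
    forall n p, N n -> N p -> ip (v n) (v p) = (n == p)%:R ;
  eigenbasis_complete :
    forall x : H,
      \sum_(0 <= n < p | n \in N) ip x (v n) *: v n @[p --> \oo] --> x }.

End SpectralSetting.

Arguments separable_space {R} H.

Section Observation.
Context {R : realType}.

Definition Gamma (x : R) : R :=
  \int[lebesgue_measure]_(s in `]0, +oo[) (s `^ (x - 1) * expR (- s)).

(* The entire function 1/Gamma on the real line:
   1/Gamma(x) = x (x + 1) ... (x + n - 1) / Gamma(x + n) for any n such that
   x + n > 0; here n is the integral part of |x| plus one. *)
Definition rGamma (x : R) : R :=
  let n := (Num.truncn `|x|).+1 in
  (\prod_(i < n) (x + i%:R)) / Gamma (x + n%:R).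

Definition mittag_leffler (alpha beta z : R) : R :=
  \big[+%R/0]_(0 <= i <oo) (z ^+ i * rGamma (alpha * i%:R + beta)).

Definition resolvent_moment (N : set nat) (lambda a : nat -> R) (k : nat) : R :=
  \big[+%R/0]_(0 <= n <oo | n \in N) (a n / lambda n ^+ k).

Definition observation (N : set nat) (lambda a : nat -> R) (alpha t : R) : R :=
  \big[+%R/0]_(0 <= n <oo | n \in N)
    (a n * mittag_leffler alpha 1 (- lambda n * t `^ alpha)).

Definition lead_coeff (m : nat) (alpha : R) : R :=
  (-1) ^+ m.+1 * rGamma (1 - m%:R * alpha).

End Observation.

(* Main.v *)
Require Import Defs.
From HB Require Import structures.
From mathcomp Require Import all_boot all_order all_algebra.
From mathcomp Require Import all_classical all_reals all_analysis.
From mathcomp Require Import measurable_realfun complex ring lra.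
Import Order.TTheory GRing.Theory Num.Theory numFieldNormedType.Exports.
Import Normc.
Set Implicit Arguments.
Unset Strict Implicit.
Unset Printing Implicit Defensive.
Local Open Scope classical_set_scope.
Local Open Scope ring_scope.
Local Notation Re := complex.Re.
Local Notation Im := complex.Im.

(** Put t = e^tau.  For 0 < al < 1 and x > 0, E_al(-x) is the Hankel contour
    integral of e^z / (1 + x z^(-al)) dz / (2 pi i z).  Expanding the fraction in
    powers of z^al / x and using Hankel's formula for 1 / Gamma term by term,
    E_al(-lambda t^al) is the sum over 1 <= k <= m of
        (-1)^(k+1) lambda^(-k) t^(-k al) / Gamma(1 - k al)
    plus a remainder of order (lambda t^al)^(-m-1).  Summed against the a_n the
    first m - 1 terms vanish with the moments S_k, and
        M_al(t) = S_m c_m(al) t^(-m al) + O(t^(-(m+1) al)).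
    Differentiating in al formally, the factor ln t that comes out of t^(-m al)
    dominates the derivative of c_m, and the remainder stays smaller by a factor
    t^(-al): for large t the sign of -S_m c_m(al) decides.

    The contour is handled in the coordinate z = e^(s + i t), now with t for
    the angle, 0 <= t <= pi: it
    becomes the vertical segment s = y and the half-line t = pi, s >= y, and
    conjugation symmetry discards t < 0.  The only complex analysis needed is
    Cauchy's theorem on rectangles ([cauchy_rectangle]), applied to the family
    e^(k z) z^c / (1 + h z^al) ([kern_cauchy]).  It makes the contour integral
    [hankel] independent of y ([hankel_const]): y = 0 bounds the remainder, a
    large y sums the series of E_al, y -> -oo identifies the integral of e^z z^c.
    Expanding the fraction is the one-step identity [hankel_split], iterated
    downwards to reach the power series of E_al ([mittag_leffler_hankel]) and
    upwards to reach the expansion at infinity ([mittag_leffler_expand]).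

    Hankel's formula ([rGammaE]) rests on the recurrence of 1 / Gamma
    ([hankel_powS]) and, for 0 < c < 1, on the limit y -> -oo combined with
    Euler's reflection formula ([Gamma_reflection]).  The latter follows from
    Gamma(c) Gamma(1 - c) = int_0^oo u^(c-1) / (1 + u) du ([Gamma_mul_onem]):
    Cauchy's theorem over a quarter turn relates this integral at c and at
    (c + 1) / 2 ([beta_onem_half]), and the iterates of c -> (c + 1) / 2 go to 1,
    where the integral is elementary.

    Derivatives in the order are replaced by Lipschitz bounds, uniform in lambda
    and explicit in tau ([scaled_hankel_lipschitz]); they pass to the sum over
    the spectrum ([observation_expand], [remainder_lipschitz]) and are compared
    with the leading term in [leading_term_increasing]. *)

(** * Complex numbers and Cauchy-Riemann pairs *)

Section ComplexArithmetic.
Context {R : realType}.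
Implicit Types (x y z : R[i]) (s t : R).

Lemma Re_mul x y : Re (x * y) = Re x * Re y - Im x * Im y.
Proof. by case: x y => [a b] [c d]. Qed.

Lemma Im_mul x y : Im (x * y) = Re x * Im y + Im x * Re y.
Proof. by case: x y => [a b] [c d]. Qed.

Lemma Re_add x y : Re (x + y) = Re x + Re y.
Proof. by case: x y => [a b] [c d]. Qed.

Lemma Im_add x y : Im (x + y) = Im x + Im y.
Proof. by case: x y => [a b] [c d]. Qed.

Lemma Re_opp x : Re (- x) = - Re x. Proof. by case: x. Qed.

Lemma Im_opp x : Im (- x) = - Im x. Proof. by case: x. Qed.

Lemma Re_inv x : Re x^-1 = Re x / (Re x ^+ 2 + Im x ^+ 2).
Proof. by case: x. Qed.

Lemma Im_inv x : Im x^-1 = - Im x / (Re x ^+ 2 + Im x ^+ 2).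
Proof. by case: x => [a b]; rewrite mulNr. Qed.

Lemma sqr_normcE x : normc x ^+ 2 = Re x ^+ 2 + Im x ^+ 2.
Proof. by case: x => [a b]; rewrite sqr_sqrtr// addr_ge0 ?sqr_ge0. Qed.

Lemma normc_ge0 x : 0 <= normc x.
Proof. by case: x => a b; exact: sqrtr_ge0. Qed.

Lemma Re_le_normc x : `|Re x| <= normc x.
Proof.
rewrite -[leLHS]sqrtr_sqr -[leRHS](ger0_norm (normc_ge0 x)) -sqrtr_sqr.
by rewrite ler_wsqrtr// sqr_normcE lerDl sqr_ge0.
Qed.

Lemma Im_le_normc x : `|Im x| <= normc x.
Proof.
rewrite -[leLHS]sqrtr_sqr -[leRHS](ger0_norm (normc_ge0 x)) -sqrtr_sqr.
by rewrite ler_wsqrtr// sqr_normcE lerDr sqr_ge0.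
Qed.

Lemma normc_le_ReIm x : normc x <= `|Re x| + `|Im x|.
Proof.
rewrite -(@ler_pXn2r _ 2)// ?nnegrE ?normc_ge0 ?addr_ge0//.
rewrite sqr_normcE sqrrD !real_normK ?num_real//.
by rewrite addrAC lerDl mulrn_wge0// mulr_ge0.
Qed.

Lemma normcR (r : R) : normc (r%:C)%C = `|r|.
Proof. by rewrite /= expr0n addr0 sqrtr_sqr. Qed.

Lemma normcD x y : normc (x + y) <= normc x + normc y.
Proof. exact: (@le_normcD R x y). Qed.

Lemma normc_opp x : normc (- x) = normc x.
Proof. exact: (@normcN R x). Qed.

Lemma normc_gt0 x : x != 0 -> 0 < normc x.
Proof.
move=> x0; rewrite lt_neqAle normc_ge0 andbT eq_sym.
by apply: contra_neq x0 => /eq0_normc.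
Qed.

Definition cexp z : R[i] :=
  ((expR (Re z) * cos (Im z)) +i* (expR (Re z) * sin (Im z)))%C.

Lemma Re_cexp z : Re (cexp z) = expR (Re z) * cos (Im z). Proof. by []. Qed.

Lemma Im_cexp z : Im (cexp z) = expR (Re z) * sin (Im z). Proof. by []. Qed.

Lemma eq_ReIm x y : Re x = Re y -> Im x = Im y -> x = y.
Proof. by case: x y => [a b] [c d] /= -> ->. Qed.

Lemma cexpD x y : cexp (x + y) = cexp x * cexp y.
Proof.
apply: eq_ReIm; rewrite ?Re_mul ?Im_mul !(Re_cexp, Im_cexp) !(Re_add, Im_add) expRD.
  by rewrite cosD; ring.
by rewrite sinD; ring.
Qed.

Lemma cexp0 : cexp 0 = 1.
Proof. by apply: eq_ReIm; rewrite /= expR0 ?cos0 ?sin0 mul1r. Qed.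

Lemma normc_cexp z : normc (cexp z) = expR (Re z).
Proof.
rewrite /cexp /normc !exprMn -mulrDr cos2Dsin2 mulr1 sqrtr_sqr.
by rewrite ger0_norm// expR_ge0.
Qed.

(** The Cauchy-Riemann equations, as the existence of the two real partial
    derivatives of each component, all four read off the single number d. *)
Definition complex_derive (f : R -> R -> R[i]) (d : R[i]) s t : Prop :=
  [/\ is_derive s 1 (fun s' => Re (f s' t)) (Re d),
      is_derive s 1 (fun s' => Im (f s' t)) (Im d),
      is_derive t 1 (fun t' => Re (f s t')) (- Im d)
    & is_derive t 1 (fun t' => Im (f s t')) (Re d)].

Lemma complex_derive_cst c s t : complex_derive (fun _ _ => c) 0 s t.
Proof. by rewrite /complex_derive /= oppr0; split; exact: is_derive_cst. Qed.

Lemma complex_derive_id s t : complex_derive (fun s t => (s +i* t)%C) 1 s t.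
Proof.
rewrite /complex_derive /= oppr0; split; try exact: is_derive_cst;
  exact: is_derive_id.
Qed.

Lemma complex_deriveD f g d e s t : complex_derive f d s t ->
  complex_derive g e s t -> complex_derive (fun s t => f s t + g s t) (d + e) s t.
Proof.
move=> [f1 f2 f3 f4] [g1 g2 g3 g4]; split.
- under eq_fun do rewrite Re_add.
  by apply: is_derive_eq; rewrite Re_add.
- under eq_fun do rewrite Im_add.
  by apply: is_derive_eq; rewrite Im_add.
- under eq_fun do rewrite Re_add.
  by apply: is_derive_eq; rewrite Im_add opprD.
- under eq_fun do rewrite Im_add.
  by apply: is_derive_eq; rewrite Re_add.
Qed.

Lemma complex_deriveM f g d e s t : complex_derive f d s t ->
  complex_derive g e s t ->
  complex_derive (fun s t => f s t * g s t) (d * g s t + f s t * e) s t.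
Proof.
move=> [f1 f2 f3 f4] [g1 g2 g3 g4]; split.
- under eq_fun do rewrite Re_mul.
  by apply: is_derive_eq; rewrite !(Re_add, Im_add, Re_mul, Im_mul) /GRing.scale/=; ring.
- under eq_fun do rewrite Im_mul.
  by apply: is_derive_eq; rewrite !(Re_add, Im_add, Re_mul, Im_mul) /GRing.scale/=; ring.
- under eq_fun do rewrite Re_mul.
  by apply: is_derive_eq; rewrite !(Re_add, Im_add, Re_mul, Im_mul) /GRing.scale/=; ring.
- under eq_fun do rewrite Im_mul.
  by apply: is_derive_eq; rewrite !(Re_add, Im_add, Re_mul, Im_mul) /GRing.scale/=; ring.
Qed.

Lemma sqr_ReIm_neq0 x : x != 0 -> Re x ^+ 2 + Im x ^+ 2 != 0.
Proof. by move=> x0; rewrite -sqr_normcE sqrf_eq0 gt_eqF// normc_gt0. Qed.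

Lemma is_derive_div (f g : R -> R) s (df dg : R) :
  is_derive s 1 f df -> is_derive s 1 g dg -> g s != 0 ->
  is_derive s 1 (fun s => f s / g s) ((df * g s - f s * dg) / g s ^+ 2).
Proof.
move=> hf hg g0.
have h := is_deriveV g0 hg.
by apply: is_derive_eq; rewrite /GRing.scale/=; field.
Qed.

Lemma sqr_norm_neq0 (a b : R) : a ^+ 2 + b ^+ 2 != 0 ->
  ((a * a - b * b) ^+ 2 + (a * b + b * a) ^+ 2 != 0) && (a * a + b ^+ 2 != 0).
Proof.
move=> ab0; rewrite -expr2 ab0 andbT.
by have -> : (a ^+ 2 - b * b) ^+ 2 + (a * b + b * a) ^+ 2 =
  (a ^+ 2 + b ^+ 2) ^+ 2 by [ring]; rewrite expf_neq0.
Qed.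

Lemma complex_deriveV f d s t : f s t != 0 -> complex_derive f d s t ->
  complex_derive (fun s t => (f s t)^-1) (- d / f s t ^+ 2) s t.
Proof.
move=> /sqr_ReIm_neq0 f0 [f1 f2 f3 f4].
have h1 := is_deriveD (is_deriveX 2 f1) (is_deriveX 2 f2).
have h2 := is_deriveD (is_deriveX 2 f3) (is_deriveX 2 f4).
split.
- under eq_fun do rewrite Re_inv.
  apply: (is_derive_eq (is_derive_div f1 h1 f0)).
  rewrite !fctE expr2 /GRing.scale/= !(Re_mul, Re_opp, Im_opp, Re_inv, Im_inv, Im_mul)/=.
  by field; exact: sqr_norm_neq0.
- under eq_fun do rewrite Im_inv.
  apply: (is_derive_eq (is_derive_div (is_deriveN f2) h1 f0)).
  rewrite !fctE expr2 /GRing.scale/= !(Re_mul, Re_opp, Im_opp, Re_inv, Im_inv, Im_mul)/=.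
  by field; exact: sqr_norm_neq0.
- under eq_fun do rewrite Re_inv.
  apply: (is_derive_eq (is_derive_div f3 h2 f0)).
  rewrite !fctE expr2 /GRing.scale/= !(Re_mul, Re_opp, Im_opp, Re_inv, Im_inv, Im_mul)/=.
  by field; exact: sqr_norm_neq0.
- under eq_fun do rewrite Im_inv.
  apply: (is_derive_eq (is_derive_div (is_deriveN f4) h2 f0)).
  rewrite !fctE expr2 /GRing.scale/= !(Re_mul, Re_opp, Im_opp, Re_inv, Im_inv, Im_mul)/=.
  by field; exact: sqr_norm_neq0.
Qed.

Lemma is_derive_comp (f g : R -> R) s (df dg : R) :
  is_derive s 1 f df -> is_derive (f s) 1 g dg ->
  is_derive s 1 (fun s => g (f s)) (dg * df).
Proof. by move=> hf hg; apply: is_derive1_comp. Qed.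

Lemma complex_derive_cexp f d s t : complex_derive f d s t ->
  complex_derive (fun s t => cexp (f s t)) (d * cexp (f s t)) s t.
Proof.
move=> [f1 f2 f3 f4].
have e1 := is_derive_comp f1 (is_derive_expR _).
have c1 := is_derive_comp f2 (is_derive_cos _).
have s1 := is_derive_comp f2 (is_derive_sin _).
have e2 := is_derive_comp f3 (is_derive_expR _).
have c2 := is_derive_comp f4 (is_derive_cos _).
have s2 := is_derive_comp f4 (is_derive_sin _).
split; rewrite /cexp /= ?(Re_mul, Im_mul) /=;
  apply: is_derive_eq; rewrite /GRing.scale/=; ring.
Qed.

End ComplexArithmetic.

(** * Cauchy's theorem on a rectangle *)

Section Cauchy.
Context {R : realType}.
Local Notation mu := (@lebesgue_measure R).

Lemma derivable_within_itv_integrable (a b : R) (f : R -> R) :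
  (forall t, a <= t <= b -> derivable f t 1) ->
  mu.-integrable `[a, b] (EFin \o f).
Proof.
move=> df; apply: continuous_compact_integrable; first exact: segment_compact.
by apply: derivable_within_continuous => t; rewrite in_itv/=; exact: df.
Qed.

Lemma FTC2_is_derive (a b : R) (f F : R -> R) : a < b ->
  (forall t, a <= t <= b -> is_derive t 1 F (f t)) ->
  (forall t, a <= t <= b -> derivable f t 1) ->
  \int[mu]_(t in `[a, b]) f t = F b - F a.
Proof.
move=> ab dF df; rewrite /Rintegral (@continuous_FTC2 _ f F)//.
- by apply: derivable_within_continuous => t; rewrite in_itv/=; exact: df.
- have cF : {within `[a, b], continuous F}.
    apply: derivable_within_continuous => t; rewrite in_itv/= => tab.
    by have [] := dF _ tab.
  have [cFo cFa cFb] := (continuous_within_itvP F ab).1 cF.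
  split => // t; rewrite in_itv/= => /andP[at_ tb].
  by have [] := dF t; rewrite ?ltW.
- move=> t; rewrite in_itv/= => /andP[at_ tb].
  have := dF t; rewrite !ltW// => /(_ isT) h.
  by rewrite derive1E derive_val.
Qed.

(** Cauchy's theorem on the rectangle [a, b] x [0, h], one component only.  The
    side integral of Re f is differentiable under the integral sign; by the
    Cauchy-Riemann equations its derivative is the integral of the vertical
    derivative of Im f, i.e. the increment of Im f along the side. *)
Lemma cauchy_rectangle (a b h : R) (f f' : R -> R -> R[i]) : a < b -> 0 < h ->
  (forall (s t : R), 0 <= t <= h -> complex_derive f (f' s t) s t) ->
  (forall (s t : R), 0 <= t <= h -> exists d, complex_derive f' d s t) ->
  (forall u v, exists B : R, forall s t : R, u < s < v -> 0 <= t <= h ->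
    normc (f' s t) <= B) ->
  \int[mu]_(t in `[0, h]) Re (f b t) - \int[mu]_(t in `[0, h]) Re (f a t) =
  \int[mu]_(s in `[a, b]) (Im (f s h) - Im (f s 0)).
Proof.
move=> ab h0 df df' bf'.
pose Phi s := \int[mu]_(t in `[0, h]) Re (f s t).
have h00 : 0 <= h <= h by rewrite ltW/=.
have h0h : (0:R) <= 0 <= h by rewrite lexx ltW.
have dRe (s t : R) : 0 <= t <= h -> is_derive s 1 (fun s => Re (f s t)) (Re (f' s t)).
  by move=> /(df s) [].
have dPhi (s : R) : is_derive s 1 Phi (Im (f s h) - Im (f s 0)).
  have [B hB] := bf' (s - 1) (s + 1).
  have sI : `]s - 1, s + 1[%classic s.
    by rewrite /= in_itv/= ltrBlDr ltrDl ltr01.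
  have intf (x:R) : `]s - 1, s + 1[%classic x ->
      mu.-integrable `[0, h] (EFin \o (fun t => Re (f x t))).
    move=> _; apply: derivable_within_itv_integrable => t /(df x)[_ _ d _].
    by case: d.
  have derf (x y:R) : `]s - 1, s + 1[%classic x -> `[0, h]%classic y ->
      derivable (fun s => Re (f s y)) x 1.
    by move=> _; rewrite /= in_itv/= => /(dRe x)[].
  have p1E (x y:R) : 0 <= y <= h ->
      partial1of2 (fun s t => Re (f s t)) x y = Re (f' x y).
    by move=> /(dRe x) d; rewrite partial1of2E derive_val.
  have G0 : forall y : R, 0 <= (cst (Num.max 0 B)) y.
    by move=> y /=; rewrite le_max lexx.
  have iG : mu.-integrable `[0, h] (EFin \o cst (Num.max 0 B)).
    exact: derivable_within_itv_integrable.
  have Gub (x y:R) : `]s - 1, s + 1[%classic x -> `[0, h]%classic y ->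
      `|partial1of2 (fun s t => Re (f s t)) x y| <= cst (Num.max 0 B) y.
    rewrite /= !in_itv/= => xI yh; rewrite p1E//.
    by rewrite (le_trans (Re_le_normc _))// le_max hB ?orbT.
  have mh : measurable (`[0, h]%classic : set (measurableTypeR R)) by [].
  have dd := derivable_under_integral mh sI intf derf G0 iG Gub.
  apply: (DeriveDef dd).
  rewrite -derive1E.
  rewrite (differentiation_under_integral mh sI intf derf G0 iG Gub).
  under eq_Rintegral.
    by move=> y; rewrite inE/= in_itv/= => yh; rewrite p1E//; over.
  rewrite /=.
  apply: (FTC2_is_derive h0 (F := fun t => Im (f s t))) => t.
    by move=> /(df s)[].
  by move=> /(df' s)[d [_ _ + _]] => -[].
symmetry; apply: (FTC2_is_derive ab (F := Phi)) => s _.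
apply: derivableB.
- by have [_ + _ _] := df s _ h00 => -[].
- by have [_ + _ _] := df s _ h0h => -[].
Qed.

End Cauchy.

(** * The integrands e^(k z) z^c / (1 + h z^al) *)

Section Kernel.
Context {R : realType}.
Local Notation mu := (@lebesgue_measure R).

(** With z = e^(s + i t), [kden] is 1 + h z^al and [kern] is
    e^(k z + z0) z^c / (1 + h z^al).  The contour integrals have k = 1, z0 = 0;
    the integral of u^(c-1) / (1 + u) has k = 0 and e^z0 a rotation. *)
Definition kden (h al s t : R) : R[i] :=
  1 + (h%:C * cexp (al%:C * (s +i* t)))%C.

Definition kern (k c h al : R) (z0 : R[i]) (s t : R) : R[i] :=
  cexp (k%:C * cexp (s +i* t) + c%:C * (s +i* t) + z0)%C / kden h al s t.

Lemma Re_realM (a : R) (z : R[i]) : Re ((a%:C)%C * z) = a * Re z.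
Proof. by rewrite Re_mul /= mul0r subr0. Qed.

Lemma Im_realM (a : R) (z : R[i]) : Im ((a%:C)%C * z) = a * Im z.
Proof. by rewrite Im_mul /= mul0r addr0. Qed.

Lemma cos_half_gt0 (phi : R) : 0 <= phi < pi -> 0 < cos (phi / 2).
Proof. by move=> /andP[p0 ppi]; apply: cos_gt0_pihalf; have := pi_gt0 R; lra. Qed.

(** On a sector of opening phi < pi around the positive axis the denominator
    1 + rho e^(i psi) stays away from zero, uniformly in rho: its modulus
    squared exceeds cos^2 (phi / 2) (1 + rho)^2 by a multiple of (1 - rho)^2. *)
Lemma kden_ge (h al phi s t : R) : 0 <= h -> phi < pi -> 0 <= al * t <= phi ->
  cos (phi / 2) * (1 + h * expR (al * s)) <= normc (kden h al s t).
Proof.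
move=> h0 ppi /andP[at0 atp].
have p0 : 0 <= phi by exact: le_trans atp.
have rho0 : 0 <= h * expR (al * s) by rewrite mulr_ge0 ?expR_ge0.
have c0 : 0 < cos (phi / 2) by rewrite cos_half_gt0 ?p0.
rewrite -(@ler_pXn2r _ 2)// ?nnegrE ?normc_ge0//; last first.
  by rewrite mulr_ge0 ?ltW// ltr_wpDr.
rewrite sqr_normcE /kden !(Re_add, Im_add, Re_mul, Im_mul) !(Re_cexp, Im_cexp).
rewrite !(Re_add, Im_add, Re_mul, Im_mul) /= !mul0r !subr0 !addr0 add0r.
set r := expR (al * s) in rho0 *; set x := al * t in at0 atp *.
have hc : cos phi <= cos x.
  rewrite leNgt ltr_cos -?leNgt// in_itv/= ?at0 ?p0/= ltW//.
  exact: le_lt_trans ppi.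
have hcc : cos phi = 2 * cos (phi / 2) ^+ 2 - 1.
  have h2 : phi = (phi / 2) *+ 2 by rewrite -mulr_natr divfK.
  by rewrite [in LHS]h2 cos_mulr2n mulr_natl.
have hs := cos2Dsin2 x.
have c1 : cos (phi / 2) ^+ 2 <= 1.
  by rewrite -[leRHS](cos2Dsin2 (phi / 2)) lerDl sqr_ge0.
have -> : (1 + h * (r * cos x)) ^+ 2 + (h * (r * sin x)) ^+ 2 =
  1 + 2 * (h * r) * cos x + (h * r) ^+ 2.
  have -> : (1 + h * (r * cos x)) ^+ 2 + (h * (r * sin x)) ^+ 2 =
    1 + 2 * (h * r) * cos x + (h * r) ^+ 2 * (cos x ^+ 2 + sin x ^+ 2) by ring.
  by rewrite hs mulr1.
set q := h * r in rho0 *; set a := cos (phi / 2) in c1 hcc *.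
have -> : (a * (1 + q)) ^+ 2 = a ^+ 2 * (1 + q) ^+ 2 by ring.
have h1 : 2 * q * cos phi <= 2 * q * cos x by rewrite ler_wpM2l// mulr_ge0.
apply: le_trans (_ : 1 + 2 * q * cos phi + q ^+ 2 <= _); last lra.
rewrite hcc.
(* the announced multiple of (1 - rho)^2, up to rho = q and a = cos (phi / 2) *)
have : 0 <= (1 - a ^+ 2) * (1 - q) ^+ 2 by rewrite mulr_ge0 ?sqr_ge0 ?subr_ge0.
nra.
Qed.

Section Strip.
Variables (k c h al phi T : R) (z0 : R[i]).
Hypotheses (h0 : 0 <= h) (al0 : 0 <= al) (alT : al * T <= phi) (ppi : phi < pi).

Lemma kden_strip_ge (s t : R) : 0 <= t <= T ->
  cos (phi / 2) * (1 + h * expR (al * s)) <= normc (kden h al s t).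
Proof.
move=> /andP[t0 tT]; apply: kden_ge => //.
by rewrite mulr_ge0//= (le_trans _ alT)// ler_wpM2l.
Qed.

Lemma strip_cos_gt0 (t : R) : 0 <= t <= T -> 0 < cos (phi / 2).
Proof.
move=> /andP[t0 tT]; apply: cos_half_gt0; rewrite ppi andbT.
by rewrite (le_trans _ alT)// mulr_ge0// (le_trans t0).
Qed.

Lemma kden_strip_gt0 (s t : R) : 0 <= t <= T -> 0 < normc (kden h al s t).
Proof.
move=> tT; apply: lt_le_trans (kden_strip_ge _ tT).
by rewrite mulr_gt0 ?(strip_cos_gt0 tT)// ltr_wpDr// mulr_ge0 ?expR_ge0.
Qed.

Lemma kden_strip_neq0 (s t : R) : 0 <= t <= T -> kden h al s t != 0.
Proof.
move=> /(kden_strip_gt0 s); apply: contraTneq => ->.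
by rewrite normc0 ltxx.
Qed.

(** The logarithmic derivative of [kern]: bounding it separately gives the bound
    on the derivative from that on the modulus. *)
Definition kern_log (s t : R) : R[i] :=
  ((k%:C * cexp (s +i* t) + c%:C) -
   al%:C * (h%:C * cexp (al%:C * (s +i* t))) / kden h al s t)%C.

Lemma complex_deriveZ (a : R[i]) f d (s t : R) : complex_derive f d s t ->
  complex_derive (fun s t => a * f s t) (a * d) s t.
Proof.
move=> df; have := complex_deriveM (complex_derive_cst a s t) df.
by rewrite mul0r add0r.
Qed.

Lemma kden_derive (s t : R) : complex_derive (kden h al)
  (h%:C * (al%:C * cexp (al%:C * (s +i* t))))%C s t.
Proof.
have := complex_derive_id s t => /(complex_deriveZ (al%:C)%C).
move=> /complex_derive_cexp/(complex_deriveZ (h%:C)%C) d.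
have := complex_deriveD (complex_derive_cst 1 s t) d.
by rewrite add0r mulr1.
Qed.

Lemma kern_derive (s t : R) : 0 <= t <= T ->
  complex_derive (kern k c h al z0) (kern k c h al z0 s t * kern_log s t) s t.
Proof.
move=> tT; have d0 := kden_strip_neq0 s tT.
have did := complex_derive_id s t.
have de := complex_deriveZ (k%:C)%C (complex_derive_cexp did).
have dc := complex_deriveZ (c%:C)%C did.
have dn := complex_derive_cexp
  (complex_deriveD (complex_deriveD de dc) (complex_derive_cst z0 s t)).
have dd := complex_deriveV d0 (kden_derive s t).
have := complex_deriveM dn dd.
rewrite /kern /kern_log; congr (complex_derive _ _ _ _).
by field.
Qed.

Lemma kern_log_derive (s t : R) : 0 <= t <= T ->
  exists d, complex_derive kern_log d s t.
Proof.
move=> tT; have d0 := kden_strip_neq0 s tT.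
have did := complex_derive_id s t.
have de := complex_deriveZ (k%:C)%C (complex_derive_cexp did).
have dd := complex_deriveV d0 (kden_derive s t).
have da := complex_derive_cexp (complex_deriveZ (al%:C)%C did).
have db := complex_deriveM (complex_deriveZ (al%:C)%C (complex_deriveZ (h%:C)%C da)) dd.
have db' := complex_deriveZ (-1) db.
have := complex_deriveD (complex_deriveD de (complex_derive_cst (c%:C)%C s t)) db'.
set d := (X in complex_derive _ X) => dX.
exists d; move: dX; congr (complex_derive _ _ _ _).
by apply/funext => x; apply/funext => y; rewrite mulN1r.
Qed.

Lemma kern_norm (s t : R) : normc (kern k c h al z0 s t) =
  expR (k * (expR s * cos t) + c * s + Re z0) / normc (kden h al s t).
Proof.
rewrite /kern normcM normcV normc_cexp !(Re_add, Im_add, Re_mul, Im_mul) Re_cexp/=.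
by rewrite !mul0r !subr0.
Qed.

Lemma kern_norm_le (s t : R) : 0 <= t <= T -> normc (kern k c h al z0 s t) <=
  expR (k * (expR s * cos t) + c * s + Re z0) / cos (phi / 2).
Proof.
move=> tT; rewrite kern_norm ler_wpM2l ?expR_ge0// lef_pV2 ?posrE.
- apply: le_trans (kden_strip_ge s tT).
  apply: ler_peMr; first exact/ltW/(strip_cos_gt0 tT).
  by rewrite lerDl mulr_ge0 ?expR_ge0.
- exact: kden_strip_gt0.
- exact: strip_cos_gt0 tT.
Qed.

Lemma kern_log_le (s t : R) : 0 <= t <= T ->
  normc (kern_log s t) <= `|k| * expR s + `|c| + al / cos (phi / 2).
Proof.
move=> tT.
have kp := strip_cos_gt0 tT; have dp := kden_strip_gt0 s tT.
have dg := kden_strip_ge s tT.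
have r0 : 0 <= h * expR (al * s) by rewrite mulr_ge0 ?expR_ge0.
rewrite /kern_log (le_trans (normcD _ _))// lerD//.
  rewrite (le_trans (normcD _ _))// normcR lerD2r.
  by rewrite normcM normcR normc_cexp.
rewrite normc_opp -mulrA normcM normcR ger0_norm// ler_wpM2l//.
rewrite normcM normcV normcM normcR normc_cexp Re_realM ger0_norm//.
rewrite ler_pdivrMr// ler_pdivlMl//.
apply: le_trans dg; rewrite ler_wpM2l ?ltW//.
by rewrite /= ltrDr ltr01.
Qed.

Lemma kern_derive_bounded (u v : R) : exists B : R, forall s t : R,
  u < s < v -> 0 <= t <= T ->
  normc (kern k c h al z0 s t * kern_log s t) <= B.
Proof.
exists (expR (`|k| * expR v + `|c| * (`|u| + `|v|) + Re z0) / cos (phi / 2) *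
  (`|k| * expR v + `|c| + al / cos (phi / 2))) => s t /andP[us sv] tT.
have kp := strip_cos_gt0 tT.
rewrite normcM ler_pM ?normc_ge0//.
  apply: (le_trans (kern_norm_le s tT)).
  rewrite ler_wpM2r ?invr_ge0 ?(ltW kp)// ler_expR lerD2r lerD//.
    rewrite (le_trans (ler_norm _))// normrM ler_wpM2l//.
    rewrite normrM ger0_norm ?expR_ge0// -[leRHS]mulr1 ler_pM ?expR_ge0//.
      by rewrite ler_expR ltW.
    by rewrite ler_norml cos_geN1 cos_le1.
  rewrite (le_trans (ler_norm _))// normrM ler_wpM2l//.
  have := ler_norm v; have := ler_norm (- u); rewrite normrN.
  by rewrite ler_norml => ? ?; have := normr_ge0 u; have := normr_ge0 v; lra.
apply: (le_trans (kern_log_le s tT)).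
by rewrite !lerD2r ler_wpM2l// ler_expR ltW.
Qed.

Lemma kern_cauchy (a b : R) : a < b -> 0 < T ->
  \int[mu]_(t in `[0, T]) Re (kern k c h al z0 b t) -
  \int[mu]_(t in `[0, T]) Re (kern k c h al z0 a t) =
  \int[mu]_(s in `[a, b])
    (Im (kern k c h al z0 s T) - Im (kern k c h al z0 s 0)).
Proof.
move=> ab T0.
apply: (@cauchy_rectangle _ a b T _
  (fun s t => kern k c h al z0 s t * kern_log s t)) => //.
- by move=> s t; exact: kern_derive.
- move=> s t tT; have [d dl] := kern_log_derive s tT.
  have := complex_deriveM (kern_derive s tT) dl.
  by set e := (X in complex_derive _ X); exists e.
- exact: kern_derive_bounded.
Qed.

End Strip.
End Kernel.

(** * Integrals over half-lines *)

Section HalfLine.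
Context {R : realType}.
Local Notation mu := (@lebesgue_measure R).
Implicit Types (f : R -> R) (y : R).

Lemma derivable_continuous f : (forall t, derivable f t 1) -> continuous f.
Proof. by move=> df t; apply/differentiable_continuous/derivable1_diffP. Qed.

Lemma is_derive_expRN y : is_derive y 1 (fun s : R => - expR (- s)) (expR (- y)).
Proof. by apply: is_derive_eq; rewrite /GRing.scale/= mulrN1 opprK. Qed.

Lemma integral_expRN y :
  (\int[mu]_(s in `[y, +oo[) (expR (- s))%:E = (expR (- y))%:E)%E.
Proof.
have dE t : derivable (fun s : R => - expR (- s)) t 1.
  by have := is_derive_expRN t => -[].
rewrite (@ge0_continuous_FTC2y _ _ (fun s : R => - expR (- s)) y 0).
- by rewrite -EFinB sub0r opprK.
- by move=> x _; exact: expR_ge0.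
- apply: continuous_subspaceT => x.
  apply: (@continuous_comp _ _ _ -%R (@expR R)); first exact: opp_continuous.
  exact: continuous_expR.
- by rewrite -oppr0; apply: cvgN; exact: cvgr_expR.
- by move=> x _.
- by apply: cvg_at_right_filter; exact: (derivable_continuous dE).
- by move=> x _; rewrite derive1E; have := is_derive_expRN x => /@derive_val.
Qed.

Lemma integrable_expRN y : mu.-integrable `[y, +oo[ (EFin \o (fun s => expR (- s))).
Proof.
apply/integrableP; split.
  apply/measurable_EFinP; apply: measurable_funTS; apply: continuous_measurable_fun => x.
  apply: (@continuous_comp _ _ _ -%R (@expR R)); first exact: opp_continuous.
  exact: continuous_expR.
under eq_integral do rewrite /= ger0_norm ?expR_ge0//.
by rewrite integral_expRN ltry.
Qed.

(** Domination by B e^(-s) serves twice: it gives integrability, and the bound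
    at y lets quantities independent of y be shown to vanish. *)
Lemma dominated_ray f y (B : R) : (forall t, derivable f t 1) ->
  (forall s, y <= s -> `|f s| <= B * expR (- s)) ->
  mu.-integrable `[y, +oo[ (EFin \o f) /\
  `|\int[mu]_(s in `[y, +oo[) f s| <= B * expR (- y).
Proof.
move=> df fB.
have iB : mu.-integrable `[y, +oo[ (EFin \o (fun s => B * expR (- s))).
  have -> : EFin \o (fun s => B * expR (- s)) = (fun s => B%:E * (expR (- s))%:E)%E.
    by apply/funext => s /=; rewrite EFinM.
  by apply: integrableZl => //; exact: integrable_expRN.
have iF : mu.-integrable `[y, +oo[ (EFin \o f).
  apply: le_integrable iB => //.
    apply/measurable_EFinP; apply: measurable_funTS; apply: continuous_measurable_fun.
    exact: derivable_continuous.
  move=> x; rewrite /= in_itv/= andbT => yx.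
  by rewrite lee_fin (le_trans (fB _ yx))// ler_norm.
split => //; apply: (le_trans (le_normr_Rintegral _ iF)) => //.
have -> : B * expR (- y) = \int[mu]_(s in `[y, +oo[) (B * expR (- s)).
  rewrite RintegralZl//; last exact: integrable_expRN.
  by rewrite /Rintegral integral_expRN.
apply: le_Rintegral => //.
  have -> : EFin \o (fun t => `|f t|) = (fun t => `|(EFin \o f) t|)%E.
    by apply/funext.
  exact: integrable_norm.
by move=> x; rewrite /= in_itv/= andbT => yx; exact: fB.
Qed.

(** A power of u = e^s never beats e^(-u); the extra factor e^(-s) is what the
    half-line integrals are compared with. *)
Lemma expR_exp_bound (K : nat) (s : R) :
  expR (K%:R * s - expR s) <= K.+1`!%:R * expR (- s).
Proof.
have h := expR_ge1Dxn K (expR_ge0 s).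
have h1 : expR s ^+ K.+1 / K.+1`!%:R <= expR (expR s) by lra.
have f0 : (0 : R) < K.+1`!%:R by rewrite ltr0n fact_gt0.
rewrite expRD expRM_natl !expRN ler_pdivrMr ?expR_gt0// mulrAC.
rewrite ler_pdivlMr ?expR_gt0// -exprSr mulrC -ler_pdivrMr//.
Qed.

Lemma expR_exp_bound_ray (K : nat) (c s : R) : 0 <= s -> c <= K%:R ->
  expR (c * s - expR s) <= K.+1`!%:R * expR (- s).
Proof.
move=> s0 cK; apply: le_trans (expR_exp_bound K s).
by rewrite ler_expR lerD2r ler_wpM2r.
Qed.

Lemma expR_exp_dominated (c y : R) : exists B : R, 0 <= B /\
  forall s, y <= s -> expR (c * s - expR s) <= B * expR (- s).
Proof.
pose K := Num.bound `|c|.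
have cK : c <= K%:R.
  by rewrite (le_trans (ler_norm _))// ltW// archi_boundP.
exists (expR ((c - K%:R) * y) * K.+1`!%:R); split; first by rewrite mulr_ge0 ?expR_ge0.
move=> s ys.
apply: (@le_trans _ _ (expR ((c - K%:R) * y) * expR (K%:R * s - expR s))).
  rewrite -expRD ler_expR.
  have : (c - K%:R) * s <= (c - K%:R) * y by rewrite ler_wnM2l// subr_le0.
  by lra.
by rewrite -mulrA ler_wpM2l ?expR_ge0// expR_exp_bound.
Qed.

Lemma expRN_bound_eq0 (x B : R) : (forall y, 0 <= y -> `|x| <= B * expR (- y)) ->
  x = 0.
Proof.
move=> h; apply/eqP; rewrite -normr_le0.
have c : (fun y : R => B * expR (- y)) y @[y --> +oo] --> (0 : R).
  by rewrite -[X in _ --> X](mulr0 B); apply: cvgMr; exact: cvgr_expR.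
rewrite -(cvg_lim (@norm_hausdorff _ _) c).
apply: limr_ge; first by apply/cvg_ex; exists 0.
by near=> y; apply: h; near: y; exact: nbhs_pinfty_ge.
Unshelve. all: by end_near. Qed.

Lemma mem_itvcc (a b t : R) : t \in (`[a, b]%classic : set R) -> a <= t <= b.
Proof. by rewrite inE/= in_itv. Qed.

(** The integral plus F y does not depend on y and tends to 0 at infinity, also
    when f changes sign. *)
Lemma FTC_ray (f F : R -> R) (B y : R) :
  (forall s : R, is_derive s 1 F (f s)) -> (forall s : R, derivable f s 1) ->
  (forall y, mu.-integrable `[y, +oo[ (EFin \o f)) ->
  (forall s, 0 <= s -> `|f s| <= B * expR (- s)) ->
  (forall s, 0 <= s -> `|F s| <= B * expR (- s)) ->
  \int[mu]_(s in `[y, +oo[) f s = - F y.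
Proof.
move=> dF df intf fB FB.
pose D y := \int[mu]_(s in `[y, +oo[) f s + F y.
have D_const a b : a < b -> D a = D b.
  move=> ab; have := @Rintegral_itvB R f (BLeft a) +oo%O b (intf a).
  rewrite !bnd_simp => /(_ (ltW ab) isT).
  rewrite Rintegral_itv_obnd_cbnd; last first.
    apply: integrableS (intf a) => //.
    by apply: subset_itv => //; rewrite bnd_simp ltW.
  rewrite (FTC2_is_derive ab (f := f) (F := F))//.
  by rewrite /D => <-; ring.
suff : D y = 0 by rewrite /D => /eqP; rewrite addr_eq0 => /eqP.
apply: (@expRN_bound_eq0 _ (B + B)) => w w0.
have -> : D y = D w by case: (ltgtP y w) => [/D_const|/D_const|->].
apply: (le_trans (ler_normD _ _)); rewrite mulrDl lerD ?FB//.
apply: (proj2 (dominated_ray df _)) => s ws.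
by apply: fB; exact: le_trans ws.
Qed.

End HalfLine.

(** * The Hankel contour integral *)

Section Hankel.
Context {R : realType}.
Local Notation mu := (@lebesgue_measure R).

Lemma Rintegral_itv_le (T B : R) (f : R -> R) : 0 <= T ->
  (forall t, 0 <= t <= T -> derivable f t 1) ->
  (forall t, 0 <= t <= T -> `|f t| <= B) ->
  `|\int[mu]_(t in `[0, T]) f t| <= T * B.
Proof.
move=> T0 df fB.
have iF := derivable_within_itv_integrable df.
apply: (le_trans (le_normr_Rintegral _ iF)) => //.
have -> : T * B = \int[mu]_(t in `[0, T]) (cst B t).
  rewrite Rintegral_cst//= lebesgue_measure_itv/= lte_fin.
  case: ltP => [_|T0']; first by rewrite oppr0 adde0 mulrC.
  by rewrite (_ : T = 0) ?mul0r ?mulr0//; apply/eqP; rewrite eq_le T0 T0'.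
apply: le_Rintegral => //.
- have -> : EFin \o (fun t => `|f t|) = (fun t => `|(EFin \o f) t|)%E.
    by apply/funext.
  exact: integrable_norm.
- by apply: derivable_within_itv_integrable => t _; exact: derivable_cst.
Qed.

(** The integral of e^z g(z) dz / (2 pi i z) over the Hankel contour made of the
    arc |z| = e^y and of both sides of the negative half-line beyond it, in the
    coordinate z = e^(s + i t), where g(z) = z^c / (1 + h z^al); conjugation
    symmetry leaves the upper half of the contour only. *)
Definition hankel (c h al y : R) : R :=
  pi^-1 * (\int[mu]_(t in `[0, pi]) Re (kern 1 c h al 0 y t) +
           \int[mu]_(s in `[y, +oo[) Im (kern 1 c h al 0 s pi)).

Lemma Im_kern_axis (k c h al s : R) : Im (kern k c h al 0 s 0) = 0.
Proof.
rewrite /kern /kden Im_mul Im_inv !(Re_add, Im_add, Re_mul, Im_mul) /=.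
rewrite !(mul0r, mulr0, addr0, subr0, sin0, cos0, mulr1, add0r).
by rewrite oppr0 mul0r mulr0.
Qed.

Section Fixed.
Variables (c h al : R).
Hypotheses (h0 : 0 <= h) (al0 : 0 <= al) (al1 : al < 1).

Lemma al_pi_lt : al * pi < pi.
Proof. by rewrite -[ltRHS]mul1r ltr_pM2r ?pi_gt0. Qed.

Let kappa := cos (al * pi / 2).

Lemma kappa_gt0 : 0 < kappa.
Proof. by rewrite cos_half_gt0// al_pi_lt mulr_ge0 ?pi_ge0. Qed.

Lemma pi_mem_strip : 0 <= (pi : R) <= pi. Proof. by rewrite pi_ge0 lexx. Qed.

Lemma hankel_kern_derive (s t : R) : 0 <= t <= pi ->
  exists d, complex_derive (kern 1 c h al 0) d s t.
Proof.
move=> tpi; have := kern_derive 1 c 0 h0 al0 (lexx _) al_pi_lt s tpi.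
by set d := (X in complex_derive _ X); exists d.
Qed.

Lemma ray_derivable (s : R) : derivable (fun s => Im (kern 1 c h al 0 s pi)) s 1.
Proof. by have [d [_ [+ _] _ _]] := hankel_kern_derive s pi_mem_strip. Qed.

Lemma arc_derivable (y t : R) : 0 <= t <= pi ->
  derivable (fun t => Re (kern 1 c h al 0 y t)) t 1.
Proof. by move=> /(hankel_kern_derive y)[d [_ _ [+ _] _]]. Qed.

Lemma ray_norm_le (s : R) :
  normc (kern 1 c h al 0 s pi) <= expR (c * s - expR s) / kappa.
Proof.
apply: (le_trans (kern_norm_le 1 c 0 h0 al0 (lexx _) al_pi_lt s pi_mem_strip)).
by rewrite cospi mulrN1 mul1r addr0 addrC.
Qed.

Lemma arc_norm_le (y t : R) : 0 <= t <= pi ->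
  normc (kern 1 c h al 0 y t) <= expR (expR y + c * y) / kappa.
Proof.
move=> tpi; apply: (le_trans (kern_norm_le 1 c 0 h0 al0 (lexx _) al_pi_lt y tpi)).
rewrite ler_wpM2r ?invr_ge0 ?(ltW kappa_gt0)// ler_expR mul1r addr0 lerD2r.
by rewrite ler_piMr ?expR_ge0 ?cos_le1.
Qed.

Lemma ray_dominated (y : R) : exists B : R, forall s, y <= s ->
  normc (kern 1 c h al 0 s pi) <= B * expR (- s).
Proof.
have [B [B0 hB]] := expR_exp_dominated c y.
exists (B / kappa) => s ys; apply: (le_trans (ray_norm_le s)).
by rewrite [leRHS]mulrAC ler_wpM2r ?invr_ge0 ?(ltW kappa_gt0)// hB.
Qed.

Lemma ray_integrable (y : R) :
  mu.-integrable `[y, +oo[ (EFin \o (fun s => Im (kern 1 c h al 0 s pi))).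
Proof.
have [B hB] := ray_dominated y.
apply: (proj1 (dominated_ray (B := B) ray_derivable _)) => s ys.
exact: le_trans (Im_le_normc _) (hB _ ys).
Qed.

Lemma arc_integrable (y : R) :
  mu.-integrable `[0, pi] (EFin \o (fun t => Re (kern 1 c h al 0 y t))).
Proof. by apply: derivable_within_itv_integrable => t; exact: arc_derivable. Qed.

(** Moving the arc from y1 to y2 trades a piece of the half-line t = pi for the
    difference of the arcs; the side t = 0 contributes nothing, the integrand
    being real there. *)
Lemma hankel_const_lt (y1 y2 : R) : y1 < y2 -> hankel c h al y1 = hankel c h al y2.
Proof.
move=> y12; congr (_ * _).
have := kern_cauchy 1 c 0 h0 al0 (lexx _) al_pi_lt y12 (pi_gt0 R).
under [in X in _ = X -> _]eq_Rintegral do rewrite Im_kern_axis subr0.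
have := @Rintegral_itvB R _ (BLeft y1) +oo%O y2 (ray_integrable y1).
rewrite !bnd_simp => /(_ (ltW y12) isT).
rewrite Rintegral_itv_obnd_cbnd; last first.
  apply: integrableS (ray_integrable y1) => //.
  by apply: subset_itv => //; rewrite bnd_simp ltW.
by move=> <- ?; lra.
Qed.

Lemma hankel_const (y1 y2 : R) : hankel c h al y1 = hankel c h al y2.
Proof. by case: (ltgtP y1 y2) => [/hankel_const_lt|/hankel_const_lt|->]. Qed.

Lemma arc_le (y : R) : `|\int[mu]_(t in `[0, pi]) Re (kern 1 c h al 0 y t)| <=
  pi * (expR (expR y + c * y) / kappa).
Proof.
apply: Rintegral_itv_le => [|t tpi|t tpi]; first exact: pi_ge0.
  exact: arc_derivable.
exact: le_trans (Re_le_normc _) (arc_norm_le _ tpi).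
Qed.

End Fixed.
End Hankel.

Section HankelPow.
Context {R : realType}.
Local Notation mu := (@lebesgue_measure R).

Lemma kden0 (al s t : R) : kden 0 al s t = 1.
Proof. by rewrite /kden mul0r addr0. Qed.

Lemma kern0 (k c al : R) z0 : kern k c 0 al z0 = kern k c 0 0 z0.
Proof. by apply/funext => s; apply/funext => t; rewrite /kern !kden0. Qed.

(** The contour integral of e^z z^c, that is 1 / Gamma (1 - c). *)
Definition hankel_pow (c : R) : R := hankel c 0 0 0.

Lemma hankel_powE (c al y : R) : hankel c 0 al y = hankel_pow c.
Proof.
have -> : hankel c 0 al y = hankel c 0 0 y by rewrite /hankel kern0.
exact: hankel_const.
Qed.

Lemma kern_split (c h al s t : R) : 0 <= h -> 0 <= al -> al < 1 ->
  0 <= t <= pi ->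
  kern 1 c h al 0 s t =
  kern 1 c 0 0 0 s t - (h%:C)%C * kern 1 (c + al) h al 0 s t.
Proof.
move=> h0 al0 al1 tpi.
have d0 := kden_strip_neq0 h0 al0 (lexx _) (al_pi_lt al1) s tpi.
have cD : (((c + al)%:C)%C = (c%:C)%C + (al%:C)%C :> R[i]) by rewrite rmorphD.
move: d0; rewrite /kern kden0 divr1 cD mulrDl !addr0 addrA !cexpD => d0.
apply: (mulIf d0).
rewrite mulrBl -!mulrA mulVf// mulr1.
rewrite /kden; ring.
Qed.

(** One step of the geometric expansion:
    1 / (1 + h z^al) = 1 - h z^al / (1 + h z^al). *)
Lemma hankel_split (c h al : R) : 0 <= h -> 0 <= al -> al < 1 ->
  hankel c h al 0 = hankel_pow c - h * hankel (c + al) h al 0.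
Proof.
move=> h0 al0 al1; rewrite /hankel_pow /hankel.
have -> : \int[mu]_(t in `[0, pi]) Re (kern 1 c h al 0 0 t) =
    \int[mu]_(t in `[0, pi]) Re (kern 1 c 0 0 0 0 t) -
    h * \int[mu]_(t in `[0, pi]) Re (kern 1 (c + al) h al 0 0 t).
  rewrite -RintegralZl//; last exact: arc_integrable.
  rewrite -RintegralB//; last 2 first.
  - exact: arc_integrable.
  - apply: derivable_within_itv_integrable => t tpi.
    by apply: derivableM; [exact: derivable_cst|exact: arc_derivable].
  apply: eq_Rintegral => t /mem_itvcc tpi.
  by rewrite (kern_split _ _ h0)// Re_add Re_opp Re_realM.
have -> : \int[mu]_(s in `[0, +oo[) Im (kern 1 c h al 0 s pi) =
    \int[mu]_(s in `[0, +oo[) Im (kern 1 c 0 0 0 s pi) -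
    h * \int[mu]_(s in `[0, +oo[) Im (kern 1 (c + al) h al 0 s pi).
  rewrite -RintegralZl//; last exact: ray_integrable.
  rewrite -RintegralB//; last 2 first.
  - exact: ray_integrable.
  - have -> : EFin \o (fun s => h * Im (kern 1 (c + al) h al 0 s pi)) =
        (fun s => h%:E * (Im (kern 1 (c + al) h al 0 s pi))%:E)%E.
      by apply/funext => s /=; rewrite EFinM.
    by apply: integrableZl => //; exact: ray_integrable.
  apply: eq_Rintegral => t _.
  by rewrite (kern_split _ _ h0)// ?pi_ge0 ?lexx// Im_add Im_opp Im_realM.
by ring.
Qed.

Lemma kern_pow_derive (c s t : R) : 0 <= t <= pi ->
  complex_derive (kern 1 c 0 0 0)
    (kern 1 (c + 1) 0 0 0 s t + (c%:C)%C * kern 1 c 0 0 0 s t) s t.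
Proof.
move=> tpi.
have := kern_derive 1 c 0 (lexx 0) (lexx 0) (lexx _) (al_pi_lt (@ltr01 R)) s tpi.
congr (complex_derive _ _ _ _).
have cD : (((c + 1)%:C)%C = (c%:C)%C + 1 :> R[i]) by rewrite rmorphD.
rewrite /kern_log /kern !kden0 cD mulrDl !addr0 addrA !cexpD !divr1 !mul0r subr0.
have -> : ((1 : R)%:C)%C = (1 : R[i]) by [].
by rewrite !mul1r; ring.
Qed.

(** The recurrence of 1/Gamma: the total derivative of e^z z^c integrates to its
    boundary values on the real axis, where it is real, and at infinity, where
    it vanishes. *)
Lemma hankel_powS (c : R) : hankel_pow (c + 1) = - c * hankel_pow c.
Proof.
have al1 : (0 : R) < 1 := ltr01.
apply/eqP; rewrite mulNr -addr_eq0; apply/eqP.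
pose Bc (c : R) := (Num.bound `|c|).+1`!%:R / cos (0 * pi / 2) : R.
have ray_le (d s : R) : 0 <= s -> normc (kern 1 d 0 0 0 s pi) <= Bc d * expR (- s).
  move=> s0; apply: (le_trans (ray_norm_le d (lexx 0) (lexx 0) ltr01 s)).
  rewrite /Bc [leRHS]mulrAC ler_wpM2r//.
    by rewrite invr_ge0 ltW// kappa_gt0.
  by rewrite expR_exp_bound_ray// (le_trans (ler_norm _))// ltW// archi_boundP.
apply: (@expRN_bound_eq0 _ _
  (pi^-1 * (Bc c + (Bc (c + 1) + `|c| * Bc c)))) => y y0.
rewrite -(hankel_powE (c + 1) 0 y) -(hankel_powE c 0 y) /hankel.
set I1 := \int[mu]_(t in _) _; set I2 := \int[mu]_(t in _) _.
set I3 := \int[mu]_(t in _) _; set I4 := \int[mu]_(t in _) _.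
have arcE : I1 + c * I3 = Im (kern 1 c 0 0 0 y pi).
  rewrite /I1 /I3 -RintegralZl//; last exact: arc_integrable.
  rewrite -RintegralD//; last 2 first.
  - exact: arc_integrable.
  - apply: derivable_within_itv_integrable => t tpi.
    by apply: derivableM; [exact: derivable_cst|exact: arc_derivable].
  transitivity (Im (kern 1 c 0 0 0 y pi) - Im (kern 1 c 0 0 0 y 0)); last first.
    by rewrite Im_kern_axis subr0.
  apply: (FTC2_is_derive (pi_gt0 R) (F := fun t => Im (kern 1 c 0 0 0 y t))).
  - move=> t tpi; have [_ _ _] := kern_pow_derive c y tpi.
    by rewrite Re_add Re_realM.
  - move=> t tpi; apply: derivableD; first exact: arc_derivable.
    by apply: derivableM; [exact: derivable_cst|exact: arc_derivable].
have rayE : `|I2 + c * I4| <= (Bc (c + 1) + `|c| * Bc c) * expR (- y).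
  have dI d : forall t : R, derivable (fun s => Im (kern 1 d 0 0 0 s pi)) t 1.
    by move=> t; exact: ray_derivable.
  have bI d s : y <= s -> `|Im (kern 1 d 0 0 0 s pi)| <= Bc d * expR (- s).
    move=> ys; apply: le_trans (Im_le_normc _) (ray_le _ _ _).
    exact: le_trans ys.
  have [_ b2] := dominated_ray (dI (c + 1)) (bI (c + 1)).
  have [_ b4] := dominated_ray (dI c) (bI c).
  apply: (le_trans (ler_normD _ _)); rewrite mulrDl lerD// normrM -mulrA.
  by rewrite ler_wpM2l.
have -> : pi^-1 * (I1 + I2) + c * (pi^-1 * (I3 + I4)) =
    pi^-1 * ((I1 + c * I3) + (I2 + c * I4)) by ring.
rewrite normrM ger0_norm ?invr_ge0 ?pi_ge0// -mulrA.
rewrite ler_wpM2l ?invr_ge0 ?pi_ge0// (le_trans (ler_normD _ _))//.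
rewrite mulrDl lerD// arcE.
exact: le_trans (Im_le_normc _) (ray_le _ _ _).
Qed.

End HankelPow.

(** * The Gamma function in the coordinate s = ln u *)

Section LogGamma.
Context {R : realType}.
Local Notation mu := (@lebesgue_measure R).

Implicit Types z s y : R.

(** The integrand of Gamma z in the coordinate s = ln u. *)
Definition gamma_log (z s : R) : R := expR (z * s - expR s).

Lemma gamma_log_ge0 z s : 0 <= gamma_log z s. Proof. exact: expR_ge0. Qed.

Lemma gamma_log_derive z s :
  is_derive s 1 (gamma_log z) (z * gamma_log z s - gamma_log (z + 1) s).
Proof.
have -> : gamma_log (z + 1) s = gamma_log z s * expR s.
  by rewrite /gamma_log mulrDl mul1r addrAC [RHS]mulrC -expRD addrC.
have h1 : is_derive s 1 (fun s : R => z * s - expR s) (z - expR s).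
  by apply: is_derive_eq; rewrite /GRing.scale/= mulr1.
have := is_derive_comp h1 (is_derive_expR _).
by rewrite /gamma_log mulrBr mulrC.
Qed.

Lemma gamma_log_derivable z s : derivable (gamma_log z) s 1.
Proof. by have := gamma_log_derive z s => -[]. Qed.

Lemma gamma_log_continuous z : continuous (gamma_log z).
Proof. exact: (derivable_continuous (@gamma_log_derivable z)). Qed.

Lemma gamma_log_measurable z : measurable_fun setT (gamma_log z).
Proof. by apply: continuous_measurable_fun; exact: gamma_log_continuous. Qed.

Lemma gamma_log_integrable z y : mu.-integrable `[y, +oo[ (EFin \o gamma_log z).
Proof.
have [B [B0 hB]] := expR_exp_dominated z y.
have b s : y <= s -> `|gamma_log z s| <= B * expR (- s).
  by move=> ys; rewrite ger0_norm ?gamma_log_ge0// hB.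
by have [] := dominated_ray (@gamma_log_derivable z) b.
Qed.

Definition gamma_ray (y z : R) : R := \int[mu]_(s in `[y, +oo[) gamma_log z s.

(** Integration by parts, with a boundary term at y that vanishes as y -> -oo
    when z > 0. *)
Lemma gamma_rayS y z : gamma_ray y (z + 1) = z * gamma_ray y z + gamma_log z y.
Proof.
have [B1 [B10 hB1]] := expR_exp_dominated z 0.
have [B2 [B20 hB2]] := expR_exp_dominated (z + 1) 0.
have iz u : mu.-integrable `[u, +oo[ (EFin \o (fun s => z * gamma_log z s)).
  have -> : EFin \o (fun s => z * gamma_log z s) =
      (fun s => z%:E * (EFin \o gamma_log z) s)%E.
    by apply/funext => s /=; rewrite EFinM.
  by apply: integrableZl => //; exact: gamma_log_integrable.
have := @FTC_ray R (fun s => z * gamma_log z s - gamma_log (z + 1) s)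
  (gamma_log z) (B1 + `|z| * B1 + B2) y (gamma_log_derive z).
rewrite RintegralB//; last exact: gamma_log_integrable.
rewrite RintegralZl//; last exact: gamma_log_integrable.
rewrite -/(gamma_ray y z) -/(gamma_ray y (z + 1)) => h.
suff: z * gamma_ray y z - gamma_ray y (z + 1) = - gamma_log z y.
  by move=> /eqP; rewrite subr_eq => /eqP ->; ring.
apply: h.
- move=> s; apply: derivableB; last exact: gamma_log_derivable.
  by apply: derivableM; [exact: derivable_cst|exact: gamma_log_derivable].
- move=> u.
  have -> : EFin \o (fun s => z * gamma_log z s - gamma_log (z + 1) s) =
    (fun s => (EFin \o (fun s => z * gamma_log z s)%R) s -
              (EFin \o gamma_log (z + 1)%R) s)%E.
    by apply/funext => s /=; rewrite EFinB.
  by apply: integrableB => //; exact: gamma_log_integrable.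
- move=> s s0; apply: (le_trans (ler_normB _ _)).
  rewrite normrM !(ger0_norm (gamma_log_ge0 _ _)) mulrDl lerD ?hB2//.
  rewrite mulrDl -mulrA ler_wpDl ?mulr_ge0 ?expR_ge0//.
  by rewrite ler_wpM2l// hB1.
- move=> s s0; rewrite ger0_norm ?gamma_log_ge0//.
  apply: (le_trans (hB1 _ s0)); rewrite ler_wpM2r ?expR_ge0//.
  by rewrite -addrA lerDl addr_ge0// mulr_ge0.
Qed.

Lemma gamma_ray1 y : gamma_ray y 1 = expR (- expR y).
Proof.
have := gamma_rayS y 0.
by rewrite add0r mul0r add0r /gamma_log mul0r add0r.
Qed.

Lemma Gamma_ray_subst z (a : R) : 0 < a ->
  (\int[mu]_(x in `[a, +oo[) (x `^ (z - 1) * expR (- x))%:E =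
   \int[mu]_(s in `[(ln a), +oo[) (gamma_log z s)%:E)%E.
Proof.
move=> a0.
have dln (x : R) : 0 < x -> (derive1 (@ln R)) x = x^-1.
  by move=> x0; rewrite derive1E; have := is_derive1_ln x0 => /@derive_val.
have nln (x : R) : 0 < x -> \forall y \near x, (derive1 (@ln R)) y = y^-1.
  move=> x0; near=> y; apply: dln; near: y.
  exact: lt_nbhsr.
have cln (x : R) : 0 < x -> {for x, continuous (derive1 (@ln R))}.
  move=> x0; rewrite /prop_for /continuous_at dln//.
  apply: cvg_trans (inv_continuous (lt0r_neq0 x0)).
  apply: near_eq_cvg; near=> y; apply/esym.
  by near: y; exact: nln.
have posy : \forall x \near +oo, (0 : R) < x by exact: nbhs_pinfty_gt.
rewrite (@increasing_ge0_integration_by_substitutiony _ (@ln R))//.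
- apply: eq_integral => x; rewrite inE/= in_itv/= andbT => ax.
  have x0 : 0 < x by exact: lt_le_trans ax.
  congr EFin; rewrite fctE /=. rewrite dln// /gamma_log lnK ?posrE//.
  rewrite /powR gt_eqF// -[in RHS](lnK (x := x^-1)) ?posrE ?invr_gt0//.
  rewrite -!expRD lnV ?posrE//; congr expR; ring.
- move=> x y; rewrite !in_itv/= !andbT => ax ay xy.
  by rewrite ltr_ln ?posrE// (lt_le_trans a0).
- move=> x; rewrite in_itv/= andbT => ax.
  by apply: cln; exact: lt_trans ax.
- apply/cvg_ex; exists ((derive1 (@ln R)) a).
  by apply: cvg_at_right_filter; exact: cln.
- apply/cvg_ex; exists 0.
  apply: (@cvg_trans _ ((fun x : R => x^-1) @ +oo)).
    by apply: near_eq_cvg; apply: filterS posy => x x0; rewrite dln.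
  apply/cvgrVy; first by apply: filterS posy => x; rewrite invr_gt0.
  by rewrite [X in X @ _](_ : _ = id)//; apply/funext => x /=; rewrite invrK.
- split.
    move=> x; rewrite in_itv/= andbT => ax.
    by have := is_derive1_ln (lt_trans a0 ax) => -[].
  by apply: cvg_at_right_filter; exact: continuous_ln.
- apply/cvgryPge => A.
  have geA : \forall x \near +oo, expR A <= x by exact: nbhs_pinfty_ge.
  apply: filterS geA => x Ax; rewrite -[A]expRK ler_ln ?posrE ?expR_gt0//.
  exact: lt_le_trans (expR_gt0 A) Ax.
- by apply: continuous_subspaceT; exact: gamma_log_continuous.
- by move=> x _; exact: gamma_log_ge0.
Unshelve. all: by end_near. Qed.

End LogGamma.

Section GammaLimit.
Context {R : realType}.
Local Notation mu := (@lebesgue_measure R).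
Implicit Types z s y c : R.

Lemma cvg_expR_negM c : 0 < c -> expR (c * - n%:R) @[n --> \oo] --> (0 : R).
Proof.
move=> c0.
have -> : (fun n : nat => expR (c * - n%:R)) = (fun n : nat => expR (- c) ^+ n).
  by apply/funext => n; rewrite -expRM_natr mulNr mulrN.
by apply: cvg_expr; rewrite ger0_norm ?expR_ge0// expR_lt1 oppr_lt0.
Qed.

Lemma ge0_integral_exhaust (F : (set R)^nat) (D : set R) (f : R -> R) :
  (forall n, measurable (F n)) -> nondecreasing_seq F -> \bigcup_n F n = D ->
  measurable_fun D f -> (forall x, D x -> 0 <= f x) ->
  (\int[mu]_(x in F n) (f x)%:E)%E @[n --> \oo] -->
  (\int[mu]_(x in D) (f x)%:E)%E.
Proof.
move=> mF ndF <- mf f0; apply: ge0_nondecreasing_set_cvg_integral => //.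
  move=> n; apply/measurable_EFinP; apply: measurable_funS mf.
    exact: bigcup_measurable.
  by move=> x Fx; exists n.
by move=> n x Fx; rewrite lee_fin f0//; exists n.
Qed.

Lemma gamma_rayE y z :
  (\int[mu]_(s in `[y, +oo[) (gamma_log z s)%:E = (gamma_ray y z)%:E)%E.
Proof. by rewrite fineK//; apply: integrable_fin_num => //; exact: gamma_log_integrable. Qed.

Lemma bigcup_itv_Ncy : \bigcup_n (`[(- n%:R : R), +oo[%classic : set R) = setT.
Proof.
rewrite -subTset => x _; exists (Num.bound `|x|) => //=.
rewrite in_itv/= andbT lerNl (le_trans (ler_norm _))// normrN ltW//.
exact: archi_boundP.
Qed.

Lemma gamma_ray_cvg_integral z :
  (gamma_ray (- n%:R) z)%:E @[n --> \oo] --> (\int[mu]_s (gamma_log z s)%:E)%E.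
Proof.
under eq_cvg do rewrite -gamma_rayE.
apply: ge0_integral_exhaust => //.
- move=> m n mn; rewrite subsetEset; apply: subset_itv => //.
  by rewrite bnd_simp lerN2 ler_nat.
- exact: bigcup_itv_Ncy.
- exact: gamma_log_measurable.
- by move=> x _; exact: gamma_log_ge0.
Qed.

Lemma integral_gamma_log z :
  (\int[mu]_(x in `]0%R, +oo[) (x `^ (z - 1) * expR (- x))%:E =
   \int[mu]_s (gamma_log z s)%:E)%E.
Proof.
have c1 := @gamma_ray_cvg_integral z.
have c2 : (\int[mu]_(x in `[(expR (- n%:R)), +oo[)
      (x `^ (z - 1) * expR (- x))%:E)%E @[n --> \oo] -->
    (\int[mu]_(x in `]0%R, +oo[) (x `^ (z - 1) * expR (- x))%:E)%E.
  apply: ge0_integral_exhaust => //.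
  - move=> m n mn; rewrite subsetEset; apply: subset_itv => //.
    by rewrite bnd_simp ler_expR lerN2 ler_nat.
  - apply/seteqP; split => x.
      move=> [n _] /=; rewrite !in_itv/= !andbT; apply: lt_le_trans.
      exact: expR_gt0.
    rewrite /= in_itv/= andbT => x0; exists (Num.bound `|ln x|) => //=.
    rewrite in_itv/= andbT -[leRHS]lnK ?posrE// ler_expR lerNl.
    rewrite (le_trans (ler_norm _))// normrN ltW//; exact: archi_boundP.
  - apply: measurable_funM; last first.
      apply: measurable_funTS; apply: continuous_measurable_fun => x.
      apply: (@continuous_comp _ _ _ -%R (@expR R)); first exact: opp_continuous.
      exact: continuous_expR.
    by apply: measurable_funTS; exact: measurable_powR.
  - by move=> x _; rewrite mulr_ge0 ?powR_ge0 ?expR_ge0.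
have c3 : (gamma_ray (- n%:R) z)%:E @[n --> \oo] -->
    (\int[mu]_(x in `]0%R, +oo[) (x `^ (z - 1) * expR (- x))%:E)%E.
  move: c2; under eq_cvg.
    by move=> n; rewrite Gamma_ray_subst ?expR_gt0// expRK gamma_rayE; over.
  by [].
exact: (cvg_unique _ c3 c1).
Qed.

Lemma Gamma_lim z l : gamma_ray (- n%:R) z @[n --> \oo] --> l ->
  (\int[mu]_s (gamma_log z s)%:E = l%:E)%E /\ Gamma z = l.
Proof.
move=> cl; have h : (\int[mu]_s (gamma_log z s)%:E = l%:E)%E.
  apply: (cvg_unique _ (@gamma_ray_cvg_integral z)) => //.
  by apply: cvg_EFin => //; exact: nearW.
by split => //; rewrite /Gamma /Rintegral integral_gamma_log h.
Qed.

End GammaLimit.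

(** * Lipschitz bounds for the exponential *)

Section CexpLipschitz.
Context {R : realType}.

Lemma lipschitz1_of_derive (f f' : R -> R) :
  (forall x : R, is_derive x 1 f (f' x)) -> (forall x, `|f' x| <= 1) ->
  forall x y, `|f x - f y| <= `|x - y|.
Proof.
move=> df bf; suff lt (x y : R) : x < y -> `|f x - f y| <= `|x - y|.
  move=> x y; case: (ltgtP x y) => [/lt//|/lt|->]; last by rewrite !subrr normr0.
  by rewrite distrC [leRHS]distrC.
move=> xy; have [] := @MVT _ f f' _ _ xy (fun x _ => df x).
  by apply: derivable_within_continuous => z _; have [] := df z.
move=> c _ fE; rewrite distrC fE normrM [leRHS]distrC.
by rewrite ler_piMl.
Qed.

Lemma cos_lipschitz (x y : R) : `|cos x - cos y| <= `|x - y|.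
Proof.
apply: (@lipschitz1_of_derive (@cos R) (fun x => - sin x)) => z.
by rewrite normrN ler_norml sin_geN1 sin_le1.
Qed.

Lemma sin_lipschitz (x y : R) : `|sin x - sin y| <= `|x - y|.
Proof.
apply: (@lipschitz1_of_derive (@sin R) (@cos R)) => z.
by rewrite ler_norml cos_geN1 cos_le1.
Qed.

Lemma expR_lipschitz (A x y : R) : x <= A -> y <= A ->
  `|expR x - expR y| <= expR A * `|x - y|.
Proof.
suff le (u v : R) : u <= v -> v <= A -> `|expR u - expR v| <= expR A * `|u - v|.
  move=> xA yA; have [xy|/ltW yx] := leP x y. by apply: (le _ _ xy).
  by rewrite distrC [`|x - y|]distrC; exact: le.
move=> uv vA; rewrite distrC ger0_norm ?subr_ge0 ?ler_expR//.
rewrite distrC ger0_norm ?subr_ge0//.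
have -> : expR v - expR u = expR v * (1 - expR (u - v)).
  by rewrite mulrBr mulr1 -expRD [v + _]addrCA subrr addr0.
rewrite ler_pM ?expR_ge0 ?ler_expR//.
  by rewrite subr_ge0 expR_le1 subr_le0.
by have := expR_ge1Dx (u - v); lra.
Qed.

Lemma cexp_lipschitz (A : R) (u v : R[i]) : Re u <= A -> Re v <= A ->
  normc (cexp u - cexp v) <= 2 * expR A * (`|Re u - Re v| + `|Im u - Im v|).
Proof.
move=> uA vA; apply: (le_trans (normc_le_ReIm _)).
rewrite Re_add Re_opp Im_add Im_opp !(Re_cexp, Im_cexp).
set a := Re u in uA *; set b := Im u; set a' := Re v in vA *; set b' := Im v.
have part (g : R -> R) : `|g b| <= 1 -> `|g b'| <= 1 ->
    `|g b - g b'| <= `|b - b'| ->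
    `|expR a * g b - expR a' * g b'| <= expR A * (`|a - a'| + `|b - b'|).
  move=> gb gb' gbb'.
  have -> : expR a * g b - expR a' * g b' =
    (expR a - expR a') * g b + expR a' * (g b - g b') by ring.
  rewrite (le_trans (ler_normD _ _))// [leRHS]mulrDr lerD//.
    rewrite normrM -[leRHS]mulr1 ler_pM//; exact: expR_lipschitz.
  by rewrite normrM ger0_norm ?expR_ge0// ler_pM ?expR_ge0// ler_expR.
rewrite -mulrA mulr2n mulrDl mul1r lerD//; apply: part;
  rewrite ?cos_lipschitz ?sin_lipschitz// ler_norml
    ?cos_geN1 ?cos_le1 ?sin_geN1 ?sin_le1//.
Qed.

End CexpLipschitz.

(** * The Hankel integral of z^c for 0 <= c < 1 *)

Section GammaHankel.
Context {R : realType}.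
Local Notation mu := (@lebesgue_measure R).
Implicit Types z s y c : R.

Lemma Im_kern_pow_pi c s : Im (kern 1 c 0 0 0 s pi) = sin (c * pi) * gamma_log c s.
Proof.
rewrite /kern kden0 divr1 Im_cexp !(Re_add, Im_add, Re_realM, Im_realM).
rewrite Re_cexp Im_cexp /= cospi sinpi mulr0 !addr0 mul1r mulrN1 mulr0 add0r.
by rewrite mulrC /gamma_log addrC.
Qed.

(** On the half-line t = pi the imaginary part of e^z z^c is, up to sin (c pi),
    the integrand of Gamma c. *)
Lemma hankel_pow_rayE c y : pi * hankel_pow c =
  \int[mu]_(t in `[0, pi]) Re (kern 1 c 0 0 0 y t) + sin (c * pi) * gamma_ray y c.
Proof.
rewrite -(hankel_powE c 0 y) /hankel mulrA divff ?mul1r ?lt0r_neq0 ?pi_gt0//.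
congr (_ + _); rewrite /gamma_ray -RintegralZl//; last exact: gamma_log_integrable.
by apply: eq_Rintegral => s _; rewrite Im_kern_pow_pi.
Qed.

Lemma arc_cvg0 c : 0 < c ->
  \int[mu]_(t in `[0, pi]) Re (kern 1 c 0 0 0 (- n%:R) t) @[n --> \oo] --> (0 : R).
Proof.
move=> c0; apply: norm_cvg0.
have cb : pi * (expR 1 / cos (0 * pi / 2)) * expR (c * - n%:R) @[n --> \oo] -->
    (0 : R).
  by rewrite -[X in _ --> X](mulr0 (pi * (expR 1 / cos (0 * pi / 2))));
    apply: cvgMr; exact: cvg_expR_negM.
apply: (@squeeze_cvgr _ _ _ _ (cst 0) _ _ _ _ _ cb); last exact: cvg_cst.
apply: nearW => n; rewrite /= normr_ge0/=.
apply: (le_trans (arc_le c (lexx 0) (lexx 0) ltr01 _)).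
rewrite -!mulrA ler_wpM2l ?pi_ge0// [X in _ <= _ * X]mulrC [leRHS]mulrA -expRD.
have k0 : (0 : R) < cos (0 * (pi / 2)) by rewrite mul0r cos0.
rewrite ler_wpM2r ?invr_ge0 ?(ltW k0)// ler_expR lerD2r.
by rewrite -[leRHS]expR0 ler_expR lerNl oppr0.
Qed.

Lemma gamma_ray_cvg01 c : 0 < c < 1 ->
  gamma_ray (- n%:R) c @[n --> \oo] --> pi * hankel_pow c / sin (c * pi).
Proof.
move=> /andP[c0 c1].
have s0 : 0 < sin (c * pi).
  by rewrite sin_gt0_pi// mulr_gt0 ?pi_gt0//= -[ltRHS]mul1r ltr_pM2r ?pi_gt0.
have -> : (fun n : nat => gamma_ray (- n%:R) c) = (fun n : nat =>
    (pi * hankel_pow c -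
     \int[mu]_(t in `[0, pi]) Re (kern 1 c 0 0 0 (- n%:R) t)) / sin (c * pi)).
  apply/funext => n; rewrite (hankel_pow_rayE c (- n%:R)).
  by field; rewrite gt_eqF.
apply: cvgMl; rewrite -[X in _ --> X]subr0; apply: cvgB; first exact: cvg_cst.
exact: arc_cvg0.
Qed.

Lemma gamma_ray_cvg1 : gamma_ray (- n%:R) 1 @[n --> \oo] --> (1 : R).
Proof.
have -> : (fun n : nat => gamma_ray (- n%:R) 1) =
    (fun n : nat => expR (- expR (- n%:R)) : R).
  by apply/funext => n; rewrite gamma_ray1.
have c0 : (- expR (- n%:R) : R) @[n --> \oo] --> (- 0 : R).
  apply: cvgN; have := @cvg_expR_negM R 1 ltr01.
  by under eq_cvg do rewrite mul1r.
have := continuous_cvg _ (@continuous_expR R (- 0)) c0.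
by rewrite oppr0 expR0; apply.
Qed.

Lemma gamma_ray_cvgS z l : 0 < z ->
  gamma_ray (- n%:R) z @[n --> \oo] --> l ->
  gamma_ray (- n%:R) (z + 1) @[n --> \oo] --> z * l.
Proof.
move=> z0 zl.
have -> : (fun n : nat => gamma_ray (- n%:R) (z + 1)) =
    (fun n : nat => z * gamma_ray (- n%:R) z + gamma_log z (- n%:R)).
  by apply/funext => n; rewrite gamma_rayS.
rewrite -[X in _ --> X]addr0; apply: cvgD; first by apply: cvgMr.
apply: (@squeeze_cvgr _ _ _ _ (cst 0) _ _ _ _ _ (cvg_expR_negM z0)); last exact: cvg_cst.
apply: nearW => n; rewrite /= gamma_log_ge0/= /gamma_log ler_expR.
by rewrite gerDl oppr_le0 expR_ge0.
Qed.

Lemma gamma_ray_is_cvg z : 0 < z ->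
  exists l : R, gamma_ray (- n%:R) z @[n --> \oo] --> l.
Proof.
move=> z0.
suff h : forall n : nat, forall x : R, 0 < x -> x <= n.+1%:R ->
    exists l : R, gamma_ray (- n%:R) x @[n --> \oo] --> l.
  apply: (h (Num.bound `|z|)) => //.
  rewrite (le_trans (ler_norm _))// (le_trans (ltW (archi_boundP _)))//.
  by rewrite ler_nat.
elim=> [x x0 x1|n IHn x x0 xn].
  move: x1; rewrite le_eqVlt => /orP[/eqP->|x1]; first by exists 1; exact: gamma_ray_cvg1.
  by eexists; apply: gamma_ray_cvg01; rewrite x0.
have [x1|x1] := leP x 1; first by apply: IHn => //; rewrite (le_trans x1)// ler1n.
have x10 : 0 < x - 1 by rewrite subr_gt0.
have [|l hl] := IHn _ x10; first by rewrite lerBlDr natr1.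
by exists ((x - 1) * l); have := gamma_ray_cvgS x10 hl; rewrite subrK.
Qed.

Lemma integral_gamma_logE z : 0 < z ->
  (\int[mu]_s (gamma_log z s)%:E = (Gamma z)%:E)%E.
Proof.
by move=> /gamma_ray_is_cvg[l] /Gamma_lim[-> ->].
Qed.

Lemma Gamma1 : Gamma 1 = 1 :> R.
Proof. by have [_] := Gamma_lim gamma_ray_cvg1. Qed.

Lemma GammaS z : 0 < z -> Gamma (z + 1) = z * Gamma z.
Proof.
move=> z0; have [l hl] := gamma_ray_is_cvg z0.
have [_ ->] := Gamma_lim hl.
by have [_ ->] := Gamma_lim (gamma_ray_cvgS z0 hl).
Qed.

Lemma Gamma_hankel01 c : 0 < c < 1 ->
  Gamma c = pi * hankel_pow c / sin (c * pi).
Proof. by move=> /gamma_ray_cvg01/Gamma_lim[]. Qed.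

(** Here the half-line contributes sin 0 = 0 and e^z -> 1 on the shrinking arc. *)
Lemma hankel_pow0 : hankel_pow 0 = 1 :> R.
Proof.
suff c : \int[mu]_(t in `[0, pi]) Re (kern 1 0 0 0 0 (- n%:R) t) @[n --> \oo] -->
    (pi : R).
  have h n : \int[mu]_(t in `[0, pi]) Re (kern 1 0 0 0 0 (- n%:R) t) =
      pi * hankel_pow 0.
    by rewrite (hankel_pow_rayE 0 (- n%:R)) mul0r sin0 mul0r addr0.
  move: c; under eq_cvg do rewrite h.
  move/(cvg_unique _ (cvg_cst _)) => /(_ (@norm_hausdorff _ _)) e.
  by apply: (mulfI (lt0r_neq0 (pi_gt0 R))); rewrite e mulr1.
apply/subr_cvg0; apply: norm_cvg0.
have cb : pi * (4 * expR 1) * expR (- n%:R) @[n --> \oo] --> (0 : R).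
  rewrite -[X in _ --> X](mulr0 (pi * (4 * expR 1))); apply: cvgMr.
  by have := @cvg_expR_negM R 1 ltr01; under eq_cvg do rewrite mul1r.
apply: (@squeeze_cvgr _ _ _ _ (cst 0) _ _ _ _ _ cb); last exact: cvg_cst.
apply: nearW => n; rewrite /= normr_ge0/=.
have -> : \int[mu]_(t in `[0, pi]) Re (kern 1 0 0 0 0 (- n%:R) t) - pi =
    \int[mu]_(t in `[0, pi]) (Re (kern 1 0 0 0 0 (- n%:R) t) - 1).
  rewrite [RHS]RintegralB//; last 2 first.
  - exact: arc_integrable.
  - exact: derivable_within_itv_integrable.
  rewrite Rintegral_cst//= lebesgue_measure_itv/= lte_fin pi_gt0.
  by rewrite oppr0 adde0 mul1r.
rewrite -mulrA; apply: Rintegral_itv_le => [|t tpi|t tpi]; first exact: pi_ge0.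
  have d1 := @arc_derivable R 0 0 0 (lexx 0) (lexx 0) ltr01 (- n%:R) t tpi.
  apply: derivableB; [exact: d1|exact: derivable_cst].
have -> : Re (kern 1 0 0 0 0 (- n%:R) t) - 1 =
    Re (cexp (cexp ((- n%:R) +i* t)%C) - cexp 0).
  rewrite cexp0 Re_add Re_opp /kern kden0 divr1 !addr0.
  have -> : ((1 : R)%:C)%C = (1 : R[i]) by [].
  have -> : ((0 : R)%:C)%C = (0 : R[i]) by [].
  by rewrite mul1r mul0r addr0.
apply: (le_trans (Re_le_normc _)).
have en1 : expR (- n%:R) <= 1 :> R.
  by rewrite -[leRHS]expR0 ler_expR lerNl oppr0.
set w := cexp ((- n%:R) +i* t)%C.
have Rw : `|Re w| <= expR (- n%:R).
  by apply: (le_trans (Re_le_normc _)); rewrite normc_cexp.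
have Iw : `|Im w| <= expR (- n%:R).
  by apply: (le_trans (Im_le_normc _)); rewrite normc_cexp.
apply: (le_trans (@cexp_lipschitz _ 1 _ _ _ _)); rewrite ?ler01//.
  exact: le_trans (ler_norm _) (le_trans Rw en1).
rewrite !subr0; have e1 := expR_gt0 (1 : R).
have : `|Re w| + `|Im w| <= 2 * expR (- n%:R) by lra.
by move=> /(ler_wpM2l (ltW (mulr_gt0 (ltr0n _ 2) e1))) => h; lra.
Qed.

End GammaHankel.

(** * Euler's reflection formula *)

Section BetaIntegral.
Context {R : realType}.
Local Notation mu := (@lebesgue_measure R).
Implicit Types z s y c : R.

Lemma integral_scale (k : R) (f : R -> R) : 0 <= k -> continuous f ->
  (forall x, 0 <= f x) ->
  (\int[mu]_x (k * f x)%:E = k%:E * \int[mu]_x (f x)%:E)%E.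
Proof.
move=> k0 cf f0; under eq_integral do rewrite EFinM.
rewrite ge0_integralZl//.
- by apply/measurable_EFinP; exact: continuous_measurable_fun.
- by move=> x _; rewrite lee_fin.
Qed.

Lemma integral_translate (a : R) (G : R -> R) : continuous G ->
  (forall x, 0 <= G x) ->
  (\int[mu]_x (G x)%:E = \int[mu]_x (G (x + a))%:E)%E.
Proof.
move=> cG G0.
have dF (x : R) : is_derive x 1 (fun x : R => x + a) 1.
  by apply: is_derive_eq; rewrite addr0.
have F'E : derive1 (fun x : R => x + a) = cst 1.
  by apply/funext => x; rewrite derive1E; have := dF x => /@derive_val.
rewrite (@increasing_ge0_integration_by_substitutionT _ (fun x => x + a) G)//.
- by apply: eq_integral => x _; rewrite F'E fctE mulr1.
- by move=> x y xy; rewrite ltrD2r.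
- by rewrite F'E; exact: cst_continuous.
- by rewrite F'E; exact: is_cvg_cst.
- by rewrite F'E; exact: is_cvg_cst.
- apply/cvgrNyPle => A.
  have h : \forall x \near -oo, x <= A - a by exact: nbhs_ninfty_le.
  by apply: filterS h => x; rewrite lerBrDr.
- apply/cvgryPge => A.
  have h : \forall x \near +oo, A - a <= x by exact: nbhs_pinfty_ge.
  by apply: filterS h => x; rewrite lerBlDr.
Qed.

(** The integrand of int_0^oo u^(c-1) / (1 + u) du for s = ln u. *)
Definition beta_log c s : R := expR (c * s) / (1 + expR s).

Lemma onePexpR_gt0 s : 0 < 1 + expR s. Proof. by rewrite addr_gt0 ?expR_gt0. Qed.

Lemma beta_log_gt0 c s : 0 < beta_log c s.
Proof. by rewrite divr_gt0 ?expR_gt0 ?onePexpR_gt0. Qed.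

(** The inner integral of [Gamma_mul_onem], for b = ln (1 + e^s). *)
Lemma integral_gamma_log_scaled (b : R) :
  (\int[mu]_p (expR (p - expR (p + b)))%:E = (expR (- b))%:E)%E.
Proof.
have h : (\int[mu]_p (gamma_log 1 (p + b))%:E = 1%:E :> \bar R)%E.
  rewrite -(integral_translate b (@gamma_log_continuous R 1) (gamma_log_ge0 1)).
  by rewrite integral_gamma_logE// Gamma1.
have -> : (\int[mu]_p (expR (p - expR (p + b)))%:E =
           \int[mu]_p (expR (- b) * gamma_log 1 (p + b))%:E)%E.
  apply: eq_integral => p _; congr EFin.
  by rewrite /gamma_log -expRD; congr expR; ring.
rewrite (@integral_scale _ (fun p => gamma_log 1 (p + b)))// ?expR_ge0//.
  by rewrite h mule1.
  move=> x; apply: (@continuous_comp _ _ _ (fun x : R => x + b)).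
    by apply: cvgD; [exact: cvg_id|exact: cvg_cst].
  exact: gamma_log_continuous.
by move=> x; exact: gamma_log_ge0.
Qed.

(** In the product of the two integrals the shift p + s of the second variable
    separates s, and the integral over p is Gamma 1 after a further shift by
    ln (1 + e^s). *)
Lemma Gamma_mul_onem c : 0 < c < 1 ->
  (\int[mu]_s (beta_log c s)%:E = (Gamma c * Gamma (1 - c))%:E)%E.
Proof.
move=> /andP[c0 c1]; have c10 : 0 < 1 - c by rewrite subr_gt0.
pose f (z : R * R) : \bar R :=
  (gamma_log (1 - c) z.1 * gamma_log c (z.1 + z.2))%:E.
have mf : measurable_fun setT f.
  apply/measurable_EFinP; apply: measurable_funM.
    apply: measurableT_comp; last exact: measurable_fst.
    exact: gamma_log_measurable.
  apply: measurableT_comp; first exact: gamma_log_measurable.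
  by apply: measurable_funD; [exact: measurable_fst|exact: measurable_snd].
have f0 (z : R * R) : (0 <= f z)%E by rewrite lee_fin mulr_ge0 ?gamma_log_ge0.
have tonelli := @fubini_tonelli _ _ _ _ R mu mu f mf f0.
have first_p : (\int[mu]_p fubini_F mu f p = (Gamma c * Gamma (1 - c))%:E)%E.
  rewrite /fubini_F /f /=.
  have cg p : continuous (fun y : R => gamma_log c (p + y)).
    move=> x; apply: (@continuous_comp _ _ _ (fun x : R => p + x)).
      by apply: cvgD; [exact: cvg_cst|exact: cvg_id].
    exact: gamma_log_continuous.
  have inner p : (\int[mu]_y (gamma_log (1 - c) p * gamma_log c (p + y))%:E =
      (Gamma c * gamma_log (1 - c) p)%:E)%E.
    rewrite (integral_scale (gamma_log_ge0 _ _) (cg p)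
      (fun _ => gamma_log_ge0 _ _)).
    rewrite (integral_translate (- p) (cg p) (fun _ => gamma_log_ge0 _ _)).
    rewrite mulrC EFinM; congr (_ * _)%E.
    rewrite -(integral_gamma_logE c0); apply: eq_integral => y _.
    by rewrite addrCA subrr addr0.
  have Gc0 : 0 <= Gamma c.
    rewrite -lee_fin -(integral_gamma_logE c0); apply: integral_ge0 => x _.
    by rewrite lee_fin gamma_log_ge0.
  under eq_integral do rewrite inner.
  rewrite (integral_scale Gc0 (@gamma_log_continuous R (1 - c))
    (gamma_log_ge0 (1 - c))).
  by rewrite (integral_gamma_logE c10).
rewrite -first_p tonelli; apply: eq_integral => s _.
rewrite /fubini_G /f /=.
have spos : 1 + expR s \is Num.pos by rewrite posrE onePexpR_gt0.
have cg : continuous (fun p : R => expR (p - expR (p + ln (1 + expR s)))).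
  move=> p.
  apply: (@continuous_comp _ _ _ (fun p : R => p - expR (p + _))); last first.
    exact: continuous_expR.
  apply: cvgB; first exact: cvg_id.
  apply: (@continuous_comp _ _ _ (fun x : R => x + _)); last exact: continuous_expR.
  by apply: cvgD; [exact: cvg_id|exact: cvg_cst].
transitivity (\int[mu]_p
    (expR (c * s) * expR (p - expR (p + ln (1 + expR s))))%:E)%E.
  rewrite (integral_scale (expR_ge0 _) cg); last by move=> x; exact: expR_ge0.
  by rewrite integral_gamma_log_scaled -EFinM /beta_log expRN (lnK spos).
apply: eq_integral => p _; congr EFin.
rewrite /gamma_log -!expRD; congr expR.
by rewrite !expRD (lnK spos); ring.
Qed.

End BetaIntegral.

Section BetaDuplication.
Context {R : realType}.
Local Notation mu := (@lebesgue_measure R).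
Implicit Types z s y c : R.

Lemma beta_log_derivable c s : derivable (beta_log c) s 1.
Proof.
have h1 : is_derive s 1 (fun s : R => expR (c * s)) (c * expR (c * s)).
  have d : is_derive s 1 (fun s : R => c * s) c.
    by apply: is_derive_eq; rewrite /GRing.scale/= mulr1.
  by have := is_derive_comp d (is_derive_expR _); rewrite mulrC.
have h2 : is_derive s 1 (fun s : R => 1 + expR s) (expR s).
  have := is_deriveD (is_derive_cst (1 : R) s 1) (is_derive_expR s).
  by rewrite add0r.
have := is_derive_div h1 h2 (lt0r_neq0 (onePexpR_gt0 s)).
by move=> -[].
Qed.

Lemma beta_log_continuous c : continuous (beta_log c).
Proof. exact: (derivable_continuous (@beta_log_derivable c)). Qed.

Lemma cvg_Rintegral_sym (f : R -> R) (l : R) : (forall s, derivable f s 1) ->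
  (forall x, 0 <= f x) -> (\int[mu]_x (f x)%:E = l%:E)%E ->
  \int[mu]_(s in `[- n.+1%:R, n.+1%:R]) f s @[n --> \oo] --> l.
Proof.
move=> df f0 fl.
have cf := derivable_continuous df.
suff : (\int[mu]_(s in `[(- n.+1%:R : R), n.+1%:R]) f s)%:E @[n --> \oo] --> l%:E.
  by move=> /fine_cvgP[].
have E n : (\int[mu]_(s in `[(- n.+1%:R : R), n.+1%:R]) f s)%:E =
    (\int[mu]_(s in `[(- n.+1%:R)%R, n.+1%:R]) (f s)%:E)%E.
  rewrite fineK//; apply: integrable_fin_num => //.
  exact: derivable_within_itv_integrable.
have -> : (fun n => (\int[mu]_(s in `[(- n.+1%:R : R), n.+1%:R]) f s)%:E) =
    (fun n => (\int[mu]_(s in `[(- n.+1%:R)%R, n.+1%:R]) (f s)%:E)%E).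
  by apply/funext => n; exact: E.
rewrite -fl; apply: ge0_integral_exhaust => //.
- move=> m n mn; rewrite subsetEset; apply: subset_itv.
    by rewrite bnd_simp lerN2 ler_nat ltnS.
  by rewrite bnd_simp ler_nat ltnS.
- rewrite -subTset => x _; exists (Num.bound `|x|) => //=.
  have : `|x| <= (Num.bound `|x|).+1%:R.
    by rewrite (le_trans (ltW (archi_boundP _)))// ler_nat.
  by rewrite in_itv/= ler_norml.
- exact: continuous_measurable_fun.
Qed.

Lemma integral_double (G : R -> R) : continuous G -> (forall x, 0 <= G x) ->
  (\int[mu]_x (G x)%:E = 2%:E * \int[mu]_x (G (2 * x)%R)%:E)%E.
Proof.
move=> cG G0.
have dF (x : R) : is_derive x 1 (fun x : R => 2 * x) 2.
  by apply: is_derive_eq; rewrite /GRing.scale/= mulr1.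
have F'E : derive1 (fun x : R => 2 * x) = cst 2.
  by apply/funext => x; rewrite derive1E; have := dF x => /@derive_val.
rewrite (@increasing_ge0_integration_by_substitutionT _ (fun x => 2 * x) G)//.
- rewrite -(@integral_scale _ _ (fun x => G (2 * x)))//.
    by apply: eq_integral => x _; rewrite F'E fctE mulrC.
  move=> x; apply: (@continuous_comp _ _ _ (fun x : R => 2 * x)); last exact: cG.
  by apply: cvgMr; exact: cvg_id.
- by move=> x y xy; rewrite ltr_pM2l.
- by rewrite F'E; exact: cst_continuous.
- by rewrite F'E; exact: is_cvg_cst.
- by rewrite F'E; exact: is_cvg_cst.
- apply/cvgrNyPle => A.
  have h : \forall x \near -oo, x <= A / 2 by exact: nbhs_ninfty_le.
  by apply: filterS h => x; rewrite ler_pdivlMr// mulrC.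
- apply/cvgryPge => A.
  have h : \forall x \near +oo, A / 2 <= x by exact: nbhs_pinfty_ge.
  by apply: filterS h => x; rewrite ler_pdivrMr// mulrC.
Qed.

Definition beta_onem c : R := Gamma c * Gamma (1 - c).

Lemma beta_log_cvg c : 0 < c < 1 ->
  \int[mu]_(s in `[- n.+1%:R, n.+1%:R]) beta_log c s @[n --> \oo] --> beta_onem c.
Proof.
move=> c01; apply: cvg_Rintegral_sym.
- exact: beta_log_derivable.
- by move=> x; apply/ltW/beta_log_gt0.
- exact: Gamma_mul_onem.
Qed.

Lemma half_beta_cvg c : 0 < c < 1 ->
  \int[mu]_(s in `[- n.+1%:R, n.+1%:R]) beta_log c (2 * s) @[n --> \oo] -->
  beta_onem c / 2.
Proof.
move=> c01; apply: cvg_Rintegral_sym.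
- move=> s; have d : is_derive s 1 (fun x : R => 2 * x) 2.
    by apply: is_derive_eq; rewrite /GRing.scale/= mulr1.
  have [d1 _] := is_derive_comp d (derivableP (@beta_log_derivable c (2 * s))).
  exact: d1.
- by move=> x; apply/ltW/beta_log_gt0.
- have := integral_double (@beta_log_continuous c)
    (fun x => ltW (beta_log_gt0 c x)).
  rewrite Gamma_mul_onem// => h.
  have : (2^-1%:E * (Gamma c * Gamma (1 - c))%:E = 2^-1%:E *
    (2%:E * \int[mu]_x (beta_log c (2 * x)%R)%:E))%E by rewrite h.
  by rewrite muleA -!EFinM mulVf// mul1e mulrC => <-.
Qed.

(* The factor e^(-i c pi / 2) makes the numerator real on the side t = pi / 2,
   so that the imaginary part alone carries both Beta integrands. *)
Let rotated c := kern 0 c 1 1 (0 +i* (- (c * pi / 2)))%C.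

Lemma rotated_axis c s : Im (rotated c s 0) = - (sin (c * pi / 2) * beta_log c s).
Proof.
rewrite /rotated /kern /kden Im_mul Im_inv Re_inv !(Re_cexp, Im_cexp, Re_add, Im_add, Re_mul, Im_mul)/=.
rewrite !(mul0r, mulr0, subr0, addr0, add0r, mul1r, cos0, sin0, mulr1, oppr0).
rewrite sinN /beta_log expr0n addr0; field; rewrite gt_eqF//.
Qed.

Lemma rotated_half c s :
  Im (rotated c s (pi / 2)) = - beta_log ((c + 1) / 2) (2 * s).
Proof.
rewrite /rotated /kern /kden Im_mul Im_inv Re_inv !(Re_cexp, Im_cexp, Re_add, Im_add, Re_mul, Im_mul)/=.
rewrite !(mul0r, mulr0, subr0, addr0, add0r, mul1r, cos_pihalf, sin_pihalf, mulr1).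
rewrite mulrA subrr sin0 cos0 mulr1 mulr0 mul0r addr0.
rewrite /beta_log.
have -> : expR (2 * s) = expR s ^+ 2 by rewrite expRM_natl.
have -> : (c + 1) / 2 * (2 * s) = c * s + s by field.
by rewrite !expRD expr1n oppr0 expR0 mul1r; ring.
Qed.

Lemma pihalf_strip : 1 * (pi / 2) <= (pi / 2 : R). Proof. by rewrite mul1r. Qed.

Lemma pihalf_lt_pi : (pi / 2 : R) < pi. Proof. by have := pi_gt0 R; lra. Qed.

Lemma rotated_norm_le c s t : 0 <= t <= pi / 2 ->
  `|Re (rotated c s t)| <= beta_log c s / cos (pi / 2 / 2).
Proof.
move=> tT; apply: (le_trans (Re_le_normc _)).
have k0 := strip_cos_gt0 ler01 pihalf_strip pihalf_lt_pi tT.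
have dge := kden_strip_ge ler01 ler01 pihalf_strip pihalf_lt_pi s tT.
have dgt := kden_strip_gt0 ler01 ler01 pihalf_strip pihalf_lt_pi s tT.
rewrite /rotated kern_norm mul0r add0r addr0 /beta_log -mulrA -invfM.
rewrite ler_wpM2l ?expR_ge0// lef_pV2 ?posrE//.
  by apply: le_trans dge; rewrite !mul1r mulrC.
by rewrite mulr_gt0// onePexpR_gt0.
Qed.

Lemma rotated_side_le c s :
  `|\int[mu]_(t in `[0, pi / 2]) Re (rotated c s t)| <=
  pi / 2 * (beta_log c s / cos (pi / 2 / 2)).
Proof.
apply: Rintegral_itv_le => [|t tT|t tT].
- by rewrite divr_ge0 ?pi_ge0.
- have [_ _ + _] := kern_derive 0 c (0 +i* (- (c * pi / 2)))%C ler01 ler01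
    pihalf_strip pihalf_lt_pi s tT.
  by move=> -[].
- exact: rotated_norm_le.
Qed.

Lemma beta_log_ends c : 0 < c < 1 ->
  beta_log c n.+1%:R @[n --> \oo] --> (0 : R) /\
  beta_log c (- n.+1%:R) @[n --> \oo] --> (0 : R).
Proof.
move=> /andP[c0 c1]; have c10 : 0 < 1 - c by rewrite subr_gt0.
have shift d : 0 < d -> expR (d * - n.+1%:R) @[n --> \oo] --> (0 : R).
  by move=> d0; have := cvg_expR_negM d0; rewrite -(cvg_shiftS _) /=.
split.
- apply: (@squeeze_cvgr _ _ _ _ (cst 0) _ _ _ _ _ (shift _ c10)); last exact: cvg_cst.
  apply: nearW => n /=; rewrite (ltW (beta_log_gt0 _ _))/= /beta_log.
  rewrite ler_pdivrMr ?onePexpR_gt0// mulrDr mulr1 -expRD ler_wpDl ?expR_ge0//.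
  by rewrite ler_expR; lra.
- apply: (@squeeze_cvgr _ _ _ _ (cst 0) _ _ _ _ _ (shift _ c0)); last exact: cvg_cst.
  apply: nearW => n /=; rewrite (ltW (beta_log_gt0 _ _))/= /beta_log.
  by rewrite ler_pdivrMr ?onePexpR_gt0// ler_peMr ?expR_ge0// lerDl expR_ge0.
Qed.

(** The substitution s -> 2 s trades Gamma(c) Gamma(1 - c) for its value at
    (c + 1) / 2: the two integrands are the boundary values, on the real axis
    and on its image under a quarter turn, of a single holomorphic function. *)
Lemma beta_onem_half c : 0 < c < 1 ->
  beta_onem ((c + 1) / 2) = 2 * sin (c * pi / 2) * beta_onem c.
Proof.
move=> c01; have /andP[c0 c1] := c01.
have c'01 : 0 < (c + 1) / 2 < 1 by apply/andP; split; lra.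
pose side s := \int[mu]_(t in `[0, pi / 2]) Re (rotated c s t).
have green n : side n.+1%:R - side (- n.+1%:R) =
    sin (c * pi / 2) * \int[mu]_(s in `[- n.+1%:R, n.+1%:R]) beta_log c s -
    \int[mu]_(s in `[- n.+1%:R, n.+1%:R]) beta_log ((c + 1) / 2) (2 * s).
  have nn : - n.+1%:R < n.+1%:R :> R.
    by rewrite (@lt_le_trans _ _ 0) ?oppr_lt0 ?ltr0n.
  have pi2 : (0 : R) < pi / 2 by rewrite divr_gt0 ?pi_gt0.
  have := kern_cauchy 0 c (0 +i* (- (c * pi / 2)))%C ler01 ler01 pihalf_strip
    pihalf_lt_pi nn pi2.
  rewrite -/(rotated c) => ->.
  under eq_Rintegral do rewrite rotated_axis rotated_half opprK addrC.
  rewrite RintegralB//.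
  - rewrite RintegralZl//.
    by apply: derivable_within_itv_integrable => t _; exact: beta_log_derivable.
  - apply: derivable_within_itv_integrable => t _.
    by apply: derivableM; [exact: derivable_cst|exact: beta_log_derivable].
  - apply: derivable_within_itv_integrable => s _.
    have d : is_derive s 1 (fun x : R => 2 * x) 2.
      by apply: is_derive_eq; rewrite /GRing.scale/= mulr1.
    have [d1 _] := is_derive_comp d
      (derivableP (@beta_log_derivable ((c + 1) / 2) (2 * s))).
    exact: d1.
have [e1 e2] := beta_log_ends c01.
have side0 (u : nat -> R) : beta_log c (u n) @[n --> \oo] --> (0 : R) ->
    side (u n) @[n --> \oo] --> (0 : R).
  move=> u0; apply: norm_cvg0.
  have ub : pi / 2 * (beta_log c (u n) / cos (pi / 2 / 2)) @[n --> \oo] --> (0 : R).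
    rewrite -[X in _ --> X](mulr0 (pi / 2)); apply: cvgMr.
    by rewrite -[X in _ --> X](mul0r (cos (pi / 2 / 2))^-1); apply: cvgMl.
  apply: (@squeeze_cvgr _ _ _ _ (cst 0) _ _ _ _ _ ub); last exact: cvg_cst.
  by apply: nearW => n /=; rewrite normr_ge0 rotated_side_le.
have l1 : side n.+1%:R - side (- n.+1%:R) @[n --> \oo] --> (0 - 0 : R).
  by apply: cvgB; exact: side0.
have l2 : side n.+1%:R - side (- n.+1%:R) @[n --> \oo] -->
    (sin (c * pi / 2) * beta_onem c - beta_onem ((c + 1) / 2) / 2 : R).
  under eq_cvg do rewrite green.
  apply: cvgB; last exact: half_beta_cvg.
  by apply: cvgMr; exact: beta_log_cvg.
have : 0 - 0 = sin (c * pi / 2) * beta_onem c - beta_onem ((c + 1) / 2) / 2 :> R.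
  exact: (cvg_unique _ l1 l2).
by lra.
Qed.

End BetaDuplication.

Section ReflectionFormula.
Context {R : realType}.
Local Notation mu := (@lebesgue_measure R).
Implicit Types z s y c x : R.

Lemma is_derive_expRM (k s : R) : k != 0 ->
  is_derive s 1 (fun s : R => expR (k * s) / k) (expR (k * s)).
Proof.
move=> k0.
have d : is_derive s 1 (fun s : R => k * s) k.
  by apply: is_derive_eq; rewrite /GRing.scale/= mulr1.
have e := is_derive_comp d (is_derive_expR _).
have := is_deriveM e (is_derive_cst k^-1 s 1).
by rewrite scaler0 add0r /GRing.scale/= mulrCA mulVf// mulr1.
Qed.

Lemma derivable_expRM (k s : R) : derivable (fun s : R => expR (k * s)) s 1.
Proof.
have d : is_derive s 1 (fun s : R => k * s) k.
  by apply: is_derive_eq; rewrite /GRing.scale/= mulr1.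
by have [] := is_derive_comp d (is_derive_expR _).
Qed.

Lemma integral_expRM (k a b : R) : k != 0 -> a < b ->
  \int[mu]_(s in `[a, b]) expR (k * s) = (expR (k * b) - expR (k * a)) / k.
Proof.
move=> k0 ab.
rewrite mulrBl; apply: (FTC2_is_derive ab (F := fun s => expR (k * s) / k)).
  by move=> t _; exact: is_derive_expRM.
by move=> t _; exact: derivable_expRM.
Qed.

Lemma expRM_integrable (k a b : R) :
  mu.-integrable `[a, b] (EFin \o (fun s => expR (k * s))).
Proof. by apply: derivable_within_itv_integrable => t _; exact: derivable_expRM. Qed.

Lemma beta_log_integrable c (a b : R) :
  mu.-integrable `[a, b] (EFin \o beta_log c).
Proof. by apply: derivable_within_itv_integrable => t _; exact: beta_log_derivable. Qed.

(** Near c = 1 the integral behaves like that of e^(-(1 - c) s) over s >= 0; the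
    half-line s <= 0 adds at most 1 / x <= 2. *)
Lemma beta_onem_bounds x : 1 / 2 <= x < 1 ->
  (1 - x)^-1 - 1 <= beta_onem x <= (1 - x)^-1 + 2.
Proof.
move=> /andP[x2 x1]; set d := 1 - x.
have d0 : 0 < d by rewrite subr_gt0.
have x0 : 0 < x by lra.
have x01 : 0 < x < 1 by rewrite x0.
have n0 (n : nat) : (0 : R) < n.+1%:R by rewrite ltr0n.
pose L (n : nat) := \int[mu]_(s in `[(- n.+1%:R : R), 0]) beta_log x s.
pose U (n : nat) := \int[mu]_(s in `[(0 : R), n.+1%:R]) beta_log x s.
have splitE n : \int[mu]_(s in `[(- n.+1%:R : R), n.+1%:R]) beta_log x s = L n + U n.
  have := @Rintegral_itvB R (beta_log x) (BLeft (- n.+1%:R)) (BRight n.+1%:R) 0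
    (@beta_log_integrable x _ _).
  rewrite !bnd_simp oppr_le0 !ltW// => /(_ isT isT).
  rewrite Rintegral_itv_obnd_cbnd; last first.
    apply: integrableS (@beta_log_integrable x 0 n.+1%:R) => //.
    by apply: subset_itv => //; rewrite bnd_simp.
  by rewrite /L /U => <-; ring.
have Lub n : L n <= x^-1.
  apply: (@le_trans _ _ (\int[mu]_(s in `[(- n.+1%:R : R), 0]) expR (x * s))).
    apply: le_Rintegral => //; [exact: beta_log_integrable|exact: expRM_integrable|].
    move=> s _; rewrite ler_pdivrMr ?onePexpR_gt0// ler_peMr ?expR_ge0//.
    by rewrite lerDl expR_ge0.
  rewrite integral_expRM ?gt_eqF ?oppr_lt0// mulr0 expR0 ler_pdivrMr// mulVf ?gt_eqF//.
have L0 n : 0 <= L n by apply: Rintegral_ge0 => s _; exact/ltW/beta_log_gt0.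
have Uub n : U n <= d^-1.
  apply: (@le_trans _ _ (\int[mu]_(s in `[(0 : R), n.+1%:R]) expR (- d * s))).
    apply: le_Rintegral => //; [exact: beta_log_integrable|exact: expRM_integrable|].
    move=> s _; rewrite ler_pdivrMr ?onePexpR_gt0// mulrDr mulr1 -expRD.
    by rewrite ler_wpDl ?expR_ge0// ler_expR /d; lra.
  rewrite integral_expRM ?oppr_eq0 ?gt_eqF// mulr0 expR0 invrN mulrN -mulNr opprB.
  rewrite ler_pdivrMr// mulVf ?gt_eqF//.
have Ulb n : (1 - expR (d * - n.+1%:R)) / d - 1 <= U n.
  apply: (@le_trans _ _ (\int[mu]_(s in `[(0 : R), n.+1%:R]) (expR (- d * s) - expR (- (1 + d) * s)))).
    rewrite RintegralB//; [|exact: expRM_integrable|exact: expRM_integrable].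
    have nd : - d != 0 by rewrite oppr_eq0 gt_eqF.
    have dd : 0 < 1 + d by rewrite addr_gt0.
    have nd1 : - (1 + d) != 0 by rewrite oppr_eq0 gt_eqF.
    rewrite (integral_expRM nd (n0 n)) (integral_expRM nd1 (n0 n)) !mulr0 expR0.
    have -> : d * - n.+1%:R = - d * n.+1%:R by rewrite mulrN mulNr.
    set e := expR (- d * _); set e' := expR (- (1 + d) * _).
    have -> : (e - 1) / - d = (1 - e) / d by field; rewrite gt_eqF.
    have -> : (e' - 1) / - (1 + d) = (1 - e') / (1 + d) by field; rewrite gt_eqF.
    have : (1 - e') / (1 + d) <= 1.
      by rewrite ler_pdivrMr// mul1r; have := expR_ge0 (- (1 + d) * n.+1%:R); rewrite -/e'; lra.
    by lra.
  apply: le_Rintegral => //.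
  - apply: derivable_within_itv_integrable => t _.
    by apply: derivableB; exact: derivable_expRM.
  - exact: beta_log_integrable.
  - move=> s _; rewrite ler_pdivlMr ?onePexpR_gt0// mulrBl !mulrDr !mulr1 -!expRD.
    have -> : - d * s + s = x * s by rewrite /d; ring.
    have -> : - (1 + d) * s + s = - d * s by ring.
    by have := expR_ge0 (- (1 + d) * s); lra.
have cB := beta_log_cvg x01.
have cl : (1 - expR (d * - n.+1%:R)) / d - 1 @[n --> \oo] --> (d^-1 - 1 : R).
  apply: cvgB; last exact: cvg_cst.
  rewrite -[X in _ --> X]mul1r; apply: cvgMl.
  rewrite -[X in _ --> X]subr0; apply: cvgB; first exact: cvg_cst.
  by have := cvg_expR_negM d0; rewrite -(cvg_shiftS _) /=.
apply/andP; split.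
- apply: (ler_cvg_to cl cB); apply: nearW => n; rewrite splitE.
  by apply: (le_trans (Ulb n)); rewrite lerDr.
- apply: (cvgr_to_le cB); apply: nearW => n; rewrite splitE addrC lerD//.
  apply: (le_trans (Lub n)); rewrite -[leRHS]invrK lef_pV2 ?posrE//.
  by lra.
Qed.

Lemma sin_near0 x : 0 <= x -> x - x ^+ 2 <= sin x <= x.
Proof.
rewrite le_eqVlt => /orP[/eqP <-|x0]; first by rewrite sin0 expr0n subr0 lexx.
have [] := @MVT _ (@sin R) (@cos R) _ _ x0 (fun x _ => is_derive_sin x).
  exact/continuous_subspaceT/continuous_sin.
move=> u; rewrite in_itv/= => /andP[u0 ux]; rewrite sin0 !subr0 => ->.
have h := cos_lipschitz u 0.
have : 1 - u <= cos u.
  by move: h; rewrite cos0 subr0 (gtr0_norm u0) ler_norml => /andP[]; lra.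
have := cos_le1 u; nra.
Qed.

Definition reflection_defect c : R := beta_onem c * sin (c * pi) / pi.

Lemma reflection_defect_half c : 0 < c < 1 ->
  reflection_defect ((c + 1) / 2) = reflection_defect c.
Proof.
move=> c01; rewrite /reflection_defect beta_onem_half//.
have -> : (c + 1) / 2 * pi = c * pi / 2 + pi / 2 by field.
have {3}-> : c * pi = (c * pi / 2) *+ 2 by rewrite -mulr_natr divfK.
by rewrite sinDpihalf sin_mulr2n -mulr_natr; ring.
Qed.

Lemma reflection_defect_bound c : 1 / 2 <= c < 1 ->
  `|reflection_defect c - 1| <= (2 + pi) * (1 - c).
Proof.
move=> c21; have := beta_onem_bounds c21; set d := 1 - c; set B := beta_onem c.
move: c21 => /andP[c2 c1] /andP[Bl Bu].
have d0 : 0 < d by rewrite subr_gt0.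
have p0 := pi_gt0 R.
have dp0 : 0 < d * pi by rewrite mulr_gt0.
have sE : sin (c * pi) = sin (d * pi).
  have -> : c * pi = - (d * pi) + pi by rewrite /d; ring.
  by rewrite sinDpi sinN opprK.
have /andP[sl su] := sin_near0 (ltW dp0).
rewrite /reflection_defect -/B sE; set s := sin (d * pi) in sl su *.
have Bd1 : 1 - d <= B * d <= 1 + 2 * d.
  apply/andP; split.
    by move: Bl; rewrite -(ler_pM2r d0) mulrBl mulVf ?gt_eqF// mul1r.
  by move: Bu; rewrite -(ler_pM2r d0) mulrDl mulVf ?gt_eqF//.
pose q := s / (d * pi).
have q1 : q <= 1 by rewrite ler_pdivrMr// mul1r.
have q0 : 1 - d * pi <= q.
  rewrite ler_pdivlMr// mulrBl mul1r -expr2; exact: sl.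
have alg (p e : R) : p != 0 -> e != 0 -> B * s / p = (B * e) * (s / (e * p)).
  by move=> p1 e1; field; rewrite p1.
rewrite (alg _ d) ?(gt_eqF p0) ?(gt_eqF d0)// -/q.
move: Bd1 => /andP[b1 b2]; set b := B * d in b1 b2 *.
have qp : 0 <= q.
  rewrite divr_ge0 ?(ltW dp0)// sin_ge0_pi// (ltW dp0)/=.
  by rewrite -[leRHS]mul1r ler_pM2r// /d; lra.
have dle : d <= 1 / 2 by rewrite /d; lra.
have h1 : (1 - d) * (1 - d * pi) <= (1 - d) * q by rewrite ler_wpM2l//; lra.
have h2 : (1 - d) * q <= b * q by rewrite ler_wpM2r.
have h3 : b * q <= b by rewrite ler_piMr//; lra.
have h4 : 0 <= d * (d * pi) by rewrite mulr_ge0 ?(ltW d0)// ltW.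
have h5 : 0 <= d * pi by exact: ltW.
rewrite ler_norml; apply/andP; split; last by lra.
have : (1 - d) * (1 - d * pi) = 1 - d - d * pi + d * (d * pi) by ring.
by lra.
Qed.

(** Euler's reflection formula.  The quantity Gamma(c) Gamma(1 - c) sin(pi c) / pi
    is invariant under c -> (c + 1) / 2, whose iterates go to 1, where it tends
    to 1. *)
Lemma Gamma_reflection c : 0 < c < 1 ->
  Gamma c * Gamma (1 - c) = pi / sin (c * pi).
Proof.
move=> c01; have p0 := pi_gt0 R.
(* the iterates of c under c -> (c + 1) / 2 *)
pose u (k : nat) := 1 - (1 - c) / 2 ^+ k.
have /andP[c0 c1] := c01.
have k2 (k : nat) : (0 : R) < 2 ^+ k by rewrite exprn_gt0.
have u01 k : 0 < u k < 1.
  have h1 : 0 < (1 - c) / 2 ^+ k by rewrite divr_gt0// subr_gt0.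
  have h2 : (1 - c) / 2 ^+ k <= 1 - c.
    rewrite ler_pdivrMr//; apply: ler_peMr; first by rewrite subr_ge0 ltW.
    by rewrite exprn_ege1// ler1n.
  by rewrite /u; apply/andP; split; lra.
have uS k : u k.+1 = (u k + 1) / 2.
  by rewrite /u exprS; field; rewrite gt_eqF.
have uE k : reflection_defect (u k) = reflection_defect c.
  elim: k => [|k IH]; first by rewrite /u expr0 divr1; congr reflection_defect; ring.
  by rewrite uS reflection_defect_half.
have u2 k : 1 / 2 <= u k.+1 < 1.
  have /andP[a b] := u01 k; have /andP[_ ->] := u01 k.+1.
  by rewrite uS andbT; lra.
have d1 : reflection_defect c = 1.
  have cu : (2 + pi) * ((1 - c) * 2^-1 ^+ k.+1) @[k --> \oo] --> (0 : R).
    rewrite -[X in _ --> X](mulr0 (2 + pi)); apply: cvgMr.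
    rewrite -[X in _ --> X](mulr0 (1 - c)); apply: cvgMr.
    rewrite (cvg_shiftS (fun k : nat => (2^-1 : R) ^+ k)); apply: cvg_expr.
    by rewrite ger0_norm ?invr_ge0// invf_lt1// ltr1n.
  apply/eqP; rewrite -subr_eq0 -normr_le0; apply: (cvgr_to_ge cu).
  apply: nearW => k; have := reflection_defect_bound (u2 k).
  by rewrite uE /u subKr exprVn.
have s0 : 0 < sin (c * pi).
  by rewrite sin_gt0_pi// mulr_gt0//= -[ltRHS]mul1r ltr_pM2r.
move: d1; rewrite /reflection_defect /beta_onem => d1.
apply: (mulIf (lt0r_neq0 s0)); rewrite divfK ?gt_eqF//.
by move: (congr1 (fun r => r * pi) d1); rewrite mul1r divfK ?gt_eqF.
Qed.

End ReflectionFormula.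

(** * Hankel's formula *)

Section ReciprocalGamma.
Context {R : realType}.
Local Notation mu := (@lebesgue_measure R).
Implicit Types z s y c x : R.

Lemma sin_pi_gt0 c : 0 < c < 1 -> 0 < sin (c * pi).
Proof.
move=> /andP[c0 c1]; rewrite sin_gt0_pi// mulr_gt0 ?pi_gt0//=.
by rewrite -[ltRHS]mul1r ltr_pM2r ?pi_gt0.
Qed.

(** The recurrences of both factors compensate each other, so that it is enough
    to treat 0 < z <= 1; inside, the limit y -> -oo gives Gamma (1 - z) and
    reflection turns it into Gamma z. *)
Lemma Gamma_hankel_pow z : 0 < z -> Gamma z * hankel_pow (1 - z) = 1.
Proof.
move=> z0.
suff h : forall n : nat, forall x, 0 < x -> x <= n.+1%:R ->
    Gamma x * hankel_pow (1 - x) = 1.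
  apply: (h (Num.bound `|z|)) => //.
  rewrite (le_trans (ler_norm _))// (le_trans (ltW (archi_boundP _)))//.
  by rewrite ler_nat.
elim=> [x x0 x1|n IHn x x0 xn].
  move: x1; rewrite le_eqVlt => /orP[/eqP->|x1].
    by rewrite Gamma1 subrr hankel_pow0 mulr1.
  have c01 : 0 < 1 - x < 1 by apply/andP; split; lra.
  have s0 := sin_pi_gt0 c01.
  have p0 := pi_gt0 R.
  have g1 := Gamma_hankel01 c01.
  have := Gamma_reflection c01; rewrite subKr => g2.
  have e : pi * hankel_pow (1 - x) = Gamma (1 - x) * sin ((1 - x) * pi).
    by rewrite g1 divfK ?gt_eqF.
  apply: (mulfI (lt0r_neq0 p0)); rewrite mulrCA e mulrA [Gamma x * _]mulrC g2 mulr1.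
  by rewrite divfK ?gt_eqF.
have [x1|x1] := leP x 1; first by apply: IHn => //; rewrite (le_trans x1)// ler1n.
have x10 : 0 < x - 1 by rewrite subr_gt0.
have h : Gamma (x - 1) * hankel_pow (1 - (x - 1)) = 1.
  by apply: IHn => //; rewrite lerBlDr natr1.
have -> : Gamma x = (x - 1) * Gamma (x - 1) by rewrite -(GammaS x10) subrK.
rewrite -[RHS]h; have -> : 1 - (x - 1) = (1 - x) + 1 by ring.
by rewrite hankel_powS; ring.
Qed.

Lemma Gamma_neq0 z : 0 < z -> Gamma z != 0.
Proof.
move=> /Gamma_hankel_pow h; apply: contra_eq_neq h => ->.
by rewrite mul0r eq_sym oner_eq0.
Qed.

Lemma hankel_pow_prod x (n : nat) :
  hankel_pow (1 - x) = \prod_(i < n) (x + i%:R) * hankel_pow (1 - (x + n%:R)).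
Proof.
elim: n => [|n IH]; first by rewrite big_ord0 mul1r addr0.
rewrite big_ord_recr/= -mulrA IH; congr (_ * _).
have -> : 1 - (x + n%:R) = - (x + n%:R) + 1 by ring.
have -> : 1 - (x + n.+1%:R) = - (x + n%:R) by rewrite -natr1; ring.
by rewrite hankel_powS opprK.
Qed.

Lemma rGamma_shift_gt0 x : 0 < x + (Num.truncn `|x|).+1%:R.
Proof.
have h : `|x| < (Num.truncn `|x|).+1%:R by rewrite truncnS_gt.
by have := ler_norm (- x); rewrite normrN; lra.
Qed.

(** Hankel's formula, valid on the whole real line: both sides satisfy the
    recurrence of 1/Gamma, which reduces it to positive arguments. *)
Lemma rGammaE x : rGamma x = hankel_pow (1 - x).
Proof.
rewrite /rGamma (hankel_pow_prod x (Num.truncn `|x|).+1); congr (_ * _).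
have g0 := rGamma_shift_gt0 x.
apply: (mulfI (Gamma_neq0 g0)).
by rewrite Gamma_hankel_pow// divff// Gamma_neq0.
Qed.

Lemma rGamma_eq0 x : (rGamma x = 0) <-> exists i : nat, x = - i%:R.
Proof.
split=> [|[i ->]].
  move=> /eqP; rewrite mulf_eq0 invr_eq0 (negbTE (Gamma_neq0 (rGamma_shift_gt0 x))).
  rewrite orbF => /prodf_eq0[i _]; rewrite addr_eq0 => /eqP xi.
  by exists i.
rewrite /rGamma normrN ger0_norm ?ler0n// natrK.
by rewrite big_ord_recr/= addNr mulr0 mul0r.
Qed.

End ReciprocalGamma.

(** * Expansion of the Mittag-Leffler function *)

Section MittagLeffler.
Context {R : realType}.
Local Notation mu := (@lebesgue_measure R).
Variables (al x : R).
Hypotheses (al0 : 0 < al) (al1 : al < 1) (x0 : 0 < x).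

Let eta := x^-1.
Let eta0 : 0 <= eta. Proof. by rewrite invr_ge0 ltW. Qed.
Let L (c : R) := hankel c eta al 0.

Let Lsplit c : hankel_pow c = L c + eta * L (c + al).
Proof. by rewrite /L (hankel_split c eta0 (ltW al0) al1) subrK. Qed.

(** The partial sums telescope: by [hankel_split] each term of the series is a
    difference of two consecutive values of (- x)^n L (- al n). *)
Lemma mittag_leffler_partial (n : nat) :
  \sum_(0 <= i < n.+1) ((- x) ^+ i * rGamma (al * i%:R + 1)) =
  eta * L al + (- x) ^+ n * L (- (al * n%:R)).
Proof.
have rE i : rGamma (al * i%:R + 1) = hankel_pow (- (al * i%:R)).
  by rewrite rGammaE opprD addrCA subrr addr0.
elim: n => [|n IH].
  by rewrite big_nat1 rE !expr0 mulr0 oppr0 !mul1r Lsplit add0r addrC.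
rewrite big_nat_recr//= IH -addrA rE Lsplit; congr (_ + _).
have -> : - (al * n.+1%:R) + al = - (al * n%:R) by rewrite -natr1; ring.
have xe : x * eta = 1 by rewrite divff ?gt_eqF.
set a := L _; set b := L _.
have -> : (- x) ^+ n.+1 * (b + eta * a) =
    (- x) ^+ n.+1 * b - (x * eta) * ((- x) ^+ n * a) by rewrite exprS; ring.
by rewrite xe; ring.
Qed.

(** The integral may be taken over the contour with arc |z| = e^Y, on which
    |z^(- al n)| <= e^(- al n Y). *)
Lemma hankel_decay (Y : R) : exists C : R, forall n : nat,
  `|L (- (al * n%:R))| <= C * expR (- (al * Y)) ^+ n.
Proof.
have [B [B0 hB]] := expR_exp_dominated 0 Y.
pose k : R := cos (al * pi / 2).
have k0 : 0 < k by rewrite /k kappa_gt0// ltW.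
exists (pi^-1 * (pi * (expR (expR Y) / k) + B / k * expR (- Y))) => n.
set e := expR (- (al * Y)) ^+ n.
have eE : expR (- (al * n%:R) * Y) = e.
  by rewrite /e -expRM_natr; congr expR; ring.
rewrite /L (hankel_const _ eta0 (ltW al0) al1 0 Y) /hankel.
rewrite normrM ger0_norm ?invr_ge0 ?pi_ge0// -[leRHS]mulrA.
rewrite ler_wpM2l ?invr_ge0 ?pi_ge0// (le_trans (ler_normD _ _))//.
rewrite mulrDl lerD//.
  apply: (le_trans (arc_le _ eta0 (ltW al0) al1 _)).
  by rewrite expRD eE mulrAC !mulrA.
rewrite [leRHS]mulrAC.
have h s : Y <= s -> `|Im (kern 1 (- (al * n%:R)) eta al 0 s pi)| <=
    B / k * e * expR (- s).
  move=> Ys; apply: (le_trans (Im_le_normc _)).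
  apply: (le_trans (ray_norm_le _ eta0 (ltW al0) al1 s)).
  have -> : B / k * e * expR (- s) = e * (B * expR (- s)) / k by ring.
  rewrite ler_wpM2r ?invr_ge0 ?(ltW k0)// expRD ler_pM ?expR_ge0//.
    rewrite -eE ler_expR ler_wnM2l// oppr_le0 mulr_ge0//; exact: ltW.
  by have := hB _ Ys; rewrite mul0r add0r.
by have [_] := dominated_ray (@ray_derivable R _ _ _ eta0 (ltW al0) al1) h.
Qed.

Lemma mittag_leffler_hankel :
  mittag_leffler al 1 (- x) = eta * L al.
Proof.
(* on the arc |z| = e^Y the ratio x |z|^(- al) of the series is 1 / 2 *)
pose Y := ln (2 * x) / al.
have x2 : 0 < 2 * x by rewrite mulr_gt0.
have YE : expR (- (al * Y)) = (2 * x)^-1.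
  by rewrite expRN /Y mulrCA divff ?gt_eqF// mulr1 lnK ?posrE.
have [C hC] := hankel_decay Y.
rewrite /mittag_leffler; apply/cvg_lim => //.
rewrite -(cvg_shiftS _) /=.
have -> : (fun n : nat => \sum_(0 <= i < n.+1) ((- x) ^+ i * rGamma (al * i%:R + 1))) =
    (fun n : nat => eta * L al + (- x) ^+ n * L (- (al * n%:R))).
  by apply/funext => n; exact: mittag_leffler_partial.
suff c0 : (- x) ^+ n * L (- (al * n%:R)) @[n --> \oo] --> (0 : R).
  suff : eta * L al + (- x) ^+ n * L (- (al * n%:R)) @[n --> \oo] -->
    (eta * L al + 0 : R) by rewrite addr0.
  by apply: cvgD; first exact: cvg_cst.
apply: norm_cvg0.
have cb : C * 2^-1 ^+ n @[n --> \oo] --> (0 : R).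
  rewrite -[X in _ --> X](mulr0 C); apply: cvgMr; apply: cvg_expr.
  by rewrite ger0_norm ?invr_ge0// invf_lt1// ltr1n.
apply: (@squeeze_cvgr _ _ _ _ (cst 0) _ _ _ _ _ cb); last exact: cvg_cst.
apply: nearW => n; rewrite /= normr_ge0/= normrM normrX normrN (gtr0_norm x0).
have := hC n; rewrite YE => /(ler_wpM2l (exprn_ge0 n (ltW x0))) h.
apply: (le_trans h); rewrite mulrCA -exprMn invfM mulrCA divff ?gt_eqF//.
by rewrite mulr1.
Qed.

Lemma hankel_expand (m : nat) : eta * L al =
  \sum_(1 <= k < m.+1) ((-1) ^+ k.+1 * eta ^+ k * hankel_pow (k%:R * al)) +
  (-1) ^+ m * eta ^+ m.+1 * L (m.+1%:R * al).
Proof.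
elim: m => [|m IH]; first by rewrite big_geq// add0r expr0 !mul1r expr1.
rewrite big_nat_recr//= -addrA IH; congr (_ + _).
rewrite Lsplit; have -> : m.+1%:R * al + al = m.+2%:R * al by rewrite -[m.+2%:R]natr1; ring.
by rewrite !exprS; ring.
Qed.

Lemma mittag_leffler_expand (m : nat) : mittag_leffler al 1 (- x) =
  \sum_(1 <= k < m.+1) ((-1) ^+ k.+1 * eta ^+ k * hankel_pow (k%:R * al)) +
  (-1) ^+ m * eta ^+ m.+1 * L (m.+1%:R * al).
Proof. by rewrite mittag_leffler_hankel (hankel_expand m). Qed.

End MittagLeffler.

(** * Dependence of the remainder on the order *)

Section OrderDependence.
Context {R : realType}.
Local Notation mu := (@lebesgue_measure R).

Section LipschitzInTheOrder.
Variables (al1 : R) (k : nat) (del0 : R).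
Hypotheses (al10 : 0 <= al1) (al11 : al1 < 1) (del00 : 0 <= del0).

Let kap := cos (al1 * pi / 2).
Let kap0 : 0 < kap. Proof. exact: kappa_gt0. Qed.

Lemma strip_le (al : R) : al <= al1 -> al * pi <= al1 * pi.
Proof. by move=> ?; rewrite ler_pM2r ?pi_gt0. Qed.

Lemma kden_uniform_ge (h al s t : R) : 0 <= h -> 0 <= al <= al1 ->
  0 <= t <= pi -> kap <= normc (kden h al s t).
Proof.
move=> h0 /andP[a0 aa1] tpi.
apply: le_trans (kden_strip_ge h0 a0 (strip_le aa1) (al_pi_lt al11) s tpi).
by apply: ler_peMr; rewrite ?(ltW kap0)// lerDl mulr_ge0 ?expR_ge0.
Qed.

(** The integrand rescaled so that tau and the order enter only through
    p = (z e^(- tau))^al: up to e^z it is p^k / (1 + del p), see [scaled_kernE].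
    This is the integrand of the k-th remainder at lambda = 1 / del. *)
Definition scaled_kern (tau del al s t : R) : R[i] :=
  ((expR (- (al * k%:R * tau)))%:C)%C *
  kern 1 (k%:R * al) (del * expR (- (al * tau))) al 0 s t.

Lemma realM_cexp (r : R) (z : R[i]) :
  ((expR r)%:C)%C * cexp z = cexp ((r%:C)%C + z).
Proof.
rewrite cexpD; congr (_ * _); apply: eq_ReIm; rewrite !(Re_cexp, Im_cexp)/=.
  by rewrite cos0 mulr1.
by rewrite sin0 mulr0.
Qed.

Lemma scaled_kernE (tau del al s t : R) : scaled_kern tau del al s t =
  cexp (cexp (s +i* t)%C) *
  (cexp (((k%:R * al)%:C)%C * ((s - tau) +i* t)%C) /
   (1 + (del%:C)%C * cexp ((al%:C)%C * ((s - tau) +i* t)%C))).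
Proof.
have wE : ((s - tau) +i* t)%C = (s +i* t)%C - (tau%:C)%C :> R[i].
  by apply: eq_ReIm; rewrite ?Re_add ?Im_add ?Re_opp ?Im_opp/= ?oppr0 ?addr0.
have -> : 1 + (del%:C)%C * cexp ((al%:C)%C * ((s - tau) +i* t)%C) =
    kden (del * expR (- (al * tau))) al s t.
  rewrite /kden wE rmorphM -mulrA realM_cexp; congr (_ + _ * cexp _).
  by rewrite mulrBr -rmorphM rmorphN addrC.
rewrite /scaled_kern /kern addr0 !mulrA; congr (_ / _).
rewrite realM_cexp wE -cexpD; congr cexp.
have -> : ((1 : R)%:C)%C = (1 : R[i]) by [].
rewrite mul1r mulrBr -rmorphM rmorphN.
have -> : al * k%:R * tau = k%:R * al * tau by ring.
by ring.
Qed.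

(** Writing p, q for (z e^(- tau))^a, (z e^(- tau))^b, the difference of the two
    fractions is (p^k - q^k) / (1 + del p) plus
    q^k del (q - p) / ((1 + del p) (1 + del q)); differences of exponentials
    bring out the factor (b - a) |ln (z e^(- tau))|, of size 1 + tau. *)
Lemma scaled_kern_lipschitz (tau del a b s t : R) : 0 <= tau ->
  0 <= del <= del0 -> 0 <= a -> a <= b -> b <= al1 -> 0 <= s -> 0 <= t <= pi ->
  normc (scaled_kern tau del a s t - scaled_kern tau del b s t) <=
  expR (expR s * cos t) * expR (k.+2%:R * s) *
  ((b - a) * (1 + tau) * expR (- (a * k%:R * tau)) *
   (2 * (1 + pi) * (k%:R / kap + del0 / kap ^+ 2))).
Proof.
move=> tau0 /andP[d0 dd0] a0 ab ba1 s0 tpi.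
have b0 : 0 <= b by exact: le_trans ab.
have aa1 : a <= al1 by exact: le_trans ba1.
rewrite !scaled_kernE -mulrBr normcM.
have -> : normc (cexp (cexp (s +i* t)%C)) = expR (expR s * cos t).
  by rewrite normc_cexp.
rewrite -[leRHS]mulrA; apply: ler_wpM2l; first exact: expR_ge0.
set v : R[i] := ((s - tau) +i* t)%C.
have den (al : R) : 0 <= al <= al1 ->
    kap <= normc (1 + (del%:C)%C * cexp ((al%:C)%C * v)).
  move=> al01.
  have -> : 1 + (del%:C)%C * cexp ((al%:C)%C * v) =
      kden (del * expR (- (al * tau))) al s t.
    have wE : v = (s +i* t)%C - (tau%:C)%C :> R[i].
      by apply: eq_ReIm; rewrite ?Re_add ?Im_add ?Re_opp ?Im_opp/= ?oppr0 ?addr0.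
    rewrite /kden wE rmorphM -mulrA realM_cexp; congr (_ + _ * cexp _).
    by rewrite mulrBr -rmorphM rmorphN addrC.
  by apply: kden_uniform_ge => //; rewrite mulr_ge0 ?expR_ge0.
have Da := den a; have Db := den b; rewrite a0 aa1 in Da; rewrite b0 ba1 in Db.
move: Da Db => /(_ isT) Da /(_ isT) Db.
set da := 1 + _ in Da *; set db := 1 + _ in Db *.
have da0 : da != 0.
  by apply: contraTneq Da => ->; rewrite normc0 leNgt kap0.
have db0 : db != 0.
  by apply: contraTneq Db => ->; rewrite normc0 leNgt kap0.
set Pa := cexp _; set Pb := cexp _.
have -> : Pa / da - Pb / db = (Pa - Pb) / da + Pb * (db - da) / (da * db).
  by field; rewrite da0 db0.
have Re_v : `|Re v| <= s + tau.
  by rewrite /= (le_trans (ler_normB _ _))// !ger0_norm.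
have Im_v : `|Im v| <= pi.
  by move: tpi => /andP[t0 tp]; rewrite /= ger0_norm.
have W : `|Re v| + `|Im v| <= (1 + tau) * ((1 + pi) * expR s).
  have e1 := expR_ge1Dx s.
  have h1 : s + tau <= (1 + tau) * (1 + s) - 1 by nra.
  have h2 : (1 + tau) * (1 + s) <= (1 + tau) * expR s by rewrite ler_wpM2l// addr_ge0.
  have h3 : pi <= (1 + tau) * (pi * expR s).
    rewrite -[leLHS]mul1r ler_pM ?pi_ge0 ?ler01 ?lerDl//.
    by rewrite ler_peMr ?pi_ge0//; lra.
  have -> : (1 + tau) * ((1 + pi) * expR s) =
    (1 + tau) * expR s + (1 + tau) * (pi * expR s) by ring.
  lra.
have lip (j A : R) : 0 <= j -> j * a * (s - tau) <= A -> j * b * (s - tau) <= A ->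
    normc (cexp (((j * a)%:C)%C * v) - cexp (((j * b)%:C)%C * v)) <=
    2 * expR A * (j * ((b - a) * ((1 + tau) * ((1 + pi) * expR s)))).
  move=> j0 Aa Ab; apply: (le_trans (@cexp_lipschitz _ A _ _ _ _));
    rewrite ?Re_realM//.
  rewrite ler_wpM2l ?mulr_ge0 ?expR_ge0//.
  have jba : 0 <= j * (b - a) by rewrite mulr_ge0 ?subr_ge0.
  have part (y : R) : `|j * a * y - j * b * y| = j * (b - a) * `|y|.
    have -> : j * a * y - j * b * y = - (j * (b - a) * y) by ring.
    by rewrite normrN normrM ger0_norm.
  by rewrite ?Re_realM !Im_realM !part -mulrDr [leRHS]mulrA ler_wpM2l.
have bound_exp (c : R) : a <= c -> c <= 1 -> c * (s - tau) <= s - a * tau.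
  move=> ac c1.
  have h1 : c * s <= s by rewrite ler_piMl.
  have h2 : a * tau <= c * tau by rewrite ler_wpM2r.
  by rewrite mulrBr; lra.
have b1 : b <= 1 by rewrite (le_trans ba1)// ltW.
have a1 : a <= 1 by rewrite (le_trans ab).
have lipP : normc (Pa - Pb) <= 2 * expR (k%:R * (s - a * tau)) *
    (k%:R * ((b - a) * ((1 + tau) * ((1 + pi) * expR s)))).
  by apply: lip => //; rewrite -mulrA ler_wpM2l// bound_exp.
have lipp : normc (db - da) <= del0 * (2 * expR s *
    ((b - a) * ((1 + tau) * ((1 + pi) * expR s)))).
  have -> : db - da = - ((del%:C)%C * (cexp (((1 * a)%:C)%C * v) - cexp (((1 * b)%:C)%C * v))).
    by rewrite /da /db !mul1r; ring.
  rewrite normc_opp normcM normcR ger0_norm// ler_pM ?normc_ge0//.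
  have at0 : 0 <= a * tau by rewrite mulr_ge0.
  have := lip 1 s ler01; rewrite !mul1r; apply.
    by apply: le_trans (bound_exp a (lexx _) a1) _; lra.
  by apply: le_trans (bound_exp b ab b1) _; lra.
have nPb : normc Pb <= expR (k%:R * (s - a * tau)).
  rewrite normc_cexp Re_realM ler_expR -mulrA ler_wpM2l//; exact: bound_exp.
set G := (b - a) * ((1 + tau) * ((1 + pi) * expR s)) in lipP lipp.
have G0 : 0 <= G.
  rewrite mulr_ge0 ?subr_ge0// mulr_ge0 ?addr_ge0// mulr_ge0 ?expR_ge0//.
  by rewrite addr_ge0 ?pi_ge0.
set X := expR (k%:R * (s - a * tau)) in lipP nPb.
have X0 : 0 <= X by exact: expR_ge0.
have t1 : normc ((Pa - Pb) / da) <= 2 * X * (k%:R * G) / kap.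
  rewrite normcM normcV ler_pM ?normc_ge0 ?invr_ge0 ?normc_ge0//.
  by rewrite lef_pV2 ?posrE// normc_gt0.
have t2 : normc (Pb * (db - da) / (da * db)) <=
    X * (del0 * (2 * expR s * G)) / kap ^+ 2.
  rewrite normcM normcV ler_pM ?normc_ge0 ?invr_ge0 ?normc_ge0//.
    by rewrite normcM ler_pM ?normc_ge0.
  rewrite lef_pV2 ?posrE ?exprn_gt0 ?normc_gt0 ?mulf_neq0//.
  by rewrite normcM expr2 ler_pM// ltW.
apply: (le_trans (normcD _ _)); apply: (le_trans (lerD t1 t2)).
have es1 : 1 <= expR s by have := expR_ge1Dx s; lra.
have k0 : 0 <= k%:R / kap by rewrite divr_ge0// ltW.
have -> : 2 * X * (k%:R * G) / kap + X * (del0 * (2 * expR s * G)) / kap ^+ 2 =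
  2 * X * G * (k%:R / kap + del0 / kap ^+ 2 * expR s) by ring.
apply: (@le_trans _ _ (2 * X * G * ((k%:R / kap + del0 / kap ^+ 2) * expR s))).
  apply: ler_wpM2l; first by rewrite mulr_ge0// mulr_ge0.
  by rewrite [leRHS]mulrDl lerD2r ler_peMr.
rewrite le_eqVlt; apply/orP; left; apply/eqP.
have -> : X = expR (k%:R * s) * expR (- (a * k%:R * tau)).
  by rewrite /X -expRD; congr expR; ring.
have -> : expR (k.+2%:R * s) = expR (k%:R * s) * expR s * expR s.
  by rewrite -!expRD; congr expR; rewrite -[k.+2%:R]natr1 -[k.+1%:R]natr1; ring.
by rewrite /G; ring.
Qed.

Definition scaled_hankel (tau del al : R) : R :=
  expR (- (al * k%:R * tau)) *
  hankel (k%:R * al) (del * expR (- (al * tau))) al 0.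

Section ScaledHankelFixed.
Variables (tau del al : R).
Hypotheses (d0 : 0 <= del) (a0 : 0 <= al) (aa1 : al <= al1).
Let h0 : 0 <= del * expR (- (al * tau)). Proof. by rewrite mulr_ge0 ?expR_ge0. Qed.
Let alt1 : al < 1. Proof. exact: le_lt_trans al11. Qed.

Lemma scaled_arc_derivable (s t : R) : 0 <= t <= pi ->
  derivable (fun t => Re (scaled_kern tau del al s t)) t 1.
Proof.
move=> tpi; rewrite /scaled_kern.
under eq_fun do rewrite Re_realM.
apply: derivableM; first exact: derivable_cst.
exact: arc_derivable.
Qed.

Lemma scaled_ray_derivable (s : R) :
  derivable (fun s => Im (scaled_kern tau del al s pi)) s 1.
Proof.
rewrite /scaled_kern.
under eq_fun do rewrite Im_realM.
apply: derivableM; first exact: derivable_cst.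
exact: ray_derivable.
Qed.

Lemma scaled_ray_integrable :
  mu.-integrable `[0, +oo[ (EFin \o (fun s => Im (scaled_kern tau del al s pi))).
Proof.
have -> : EFin \o (fun s => Im (scaled_kern tau del al s pi)) =
    (fun s => (expR (- (al * k%:R * tau)))%:E *
      (Im (kern 1 (k%:R * al) (del * expR (- (al * tau))) al 0 s pi))%:E)%E.
  by apply/funext => s; rewrite -EFinM -Im_realM.
by apply: integrableZl => //; exact: ray_integrable.
Qed.

Lemma scaled_hankelE : scaled_hankel tau del al =
  pi^-1 * (\int[mu]_(t in `[0, pi]) Re (scaled_kern tau del al 0 t) +
           \int[mu]_(s in `[0, +oo[) Im (scaled_kern tau del al s pi)).
Proof.
rewrite /scaled_hankel /hankel mulrCA mulrDr; congr (_ * (_ + _)).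
  rewrite -RintegralZl//; last exact: arc_integrable.
  by apply: eq_Rintegral => t _; rewrite -Re_realM.
rewrite -RintegralZl//; last exact: ray_integrable.
by apply: eq_Rintegral => t _; rewrite -Im_realM.
Qed.

Lemma hankel_bounded (h : R) : 0 <= h ->
  `|hankel (k%:R * al) h al 0| <=
  pi^-1 * (pi * (expR 1 / kap) + k.+1`!%:R / kap).
Proof.
move=> hh; have ka : kap <= cos (al * pi / 2).
  rewrite /kap leNgt ltr_cos; [|rewrite in_itv/=..]; rewrite -?leNgt.
  - by rewrite ler_wpM2r// ler_wpM2r ?pi_ge0.
  - have := pi_ge0 R; have := al_pi_lt al11 => ? ?; apply/andP; split; last by lra.
    by rewrite divr_ge0// mulr_ge0.
  - have := pi_ge0 R; have := al_pi_lt alt1 => ? ?; apply/andP; split; last by lra.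
    by rewrite divr_ge0// mulr_ge0.
have ka' : (cos (al * pi / 2))^-1 <= kap^-1.
  by rewrite lef_pV2 ?posrE// kappa_gt0.
rewrite /hankel normrM ger0_norm ?invr_ge0 ?pi_ge0//.
rewrite ler_wpM2l ?invr_ge0 ?pi_ge0// (le_trans (ler_normD _ _))// lerD//.
  apply: (le_trans (arc_le _ hh a0 alt1 0)).
  rewrite ler_wpM2l ?pi_ge0// mulr0 addr0 expR0.
  by rewrite ler_wpM2l// expR_ge0.
have h1 s : 0 <= s -> `|Im (kern 1 (k%:R * al) h al 0 s pi)| <=
    k.+1`!%:R / kap * expR (- s).
  move=> s0; apply: (le_trans (Im_le_normc _)).
  apply: (le_trans (ray_norm_le _ hh a0 alt1 s)).
  rewrite [leRHS]mulrAC ler_pM ?expR_ge0 ?invr_ge0 ?(ltW (kappa_gt0 _ _))//.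
  by apply: expR_exp_bound_ray => //; rewrite ler_piMr// ltW.
have [_] := dominated_ray (@ray_derivable R _ _ _ hh a0 alt1) h1.
by rewrite oppr0 expR0 mulr1.
Qed.

End ScaledHankelFixed.

(** The rate (1 + tau) exp (- a k tau) is that of a derivative in the order of
    exp (- a k tau); the constant depends neither on tau nor on del. *)
Lemma scaled_hankel_lipschitz : exists C : R, 0 <= C /\
  forall tau del a b, 0 <= tau -> 0 <= del <= del0 -> 0 <= a -> a <= b ->
  b <= al1 ->
  `|scaled_hankel tau del a - scaled_hankel tau del b| <=
  C * ((b - a) * (1 + tau) * expR (- (a * k%:R * tau))).
Proof.
pose C1 := 2 * (1 + pi) * (k%:R / kap + del0 / kap ^+ 2) : R.
have C10 : 0 <= C1.
  rewrite mulr_ge0//; first by rewrite mulr_ge0// addr_ge0 ?pi_ge0.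
  by rewrite addr_ge0// divr_ge0 ?exprn_ge0// ltW.
exists (pi^-1 * (pi * (expR 1 * C1) + k.+3`!%:R * C1)); split.
  apply: mulr_ge0; first by rewrite invr_ge0 pi_ge0.
  apply: addr_ge0; last by apply: mulr_ge0.
  by apply: mulr_ge0; [exact: pi_ge0|apply: mulr_ge0 => //; exact: expR_ge0].
move=> tau del a b tau0 dd a0 ab ba1; have /andP[d0 dd0] := dd.
have b0 : 0 <= b by exact: le_trans ab.
have aa1 : a <= al1 by exact: le_trans ba1.
set Z := (b - a) * (1 + tau) * _.
have Z0 : 0 <= Z.
  apply: mulr_ge0; last exact: expR_ge0.
  by apply: mulr_ge0; rewrite ?subr_ge0 ?addr_ge0.
rewrite !scaled_hankelE// -mulrBr normrM ger0_norm ?invr_ge0 ?pi_ge0//.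
rewrite -[leRHS]mulrA ler_wpM2l ?invr_ge0 ?pi_ge0//.
set Ia := \int[mu]_(t in _) _; set Ja := \int[mu]_(t in _) _.
set Ib := \int[mu]_(t in _) _; set Jb := \int[mu]_(t in _) _.
have -> : Ia + Ja - (Ib + Jb) = (Ia - Ib) + (Ja - Jb) by ring.
rewrite mulrDl (le_trans (ler_normD _ _))// lerD//.
  rewrite /Ia /Ib -RintegralB//; last 2 first.
  - by apply: derivable_within_itv_integrable => t; exact: scaled_arc_derivable.
  - by apply: derivable_within_itv_integrable => t; exact: scaled_arc_derivable.
  rewrite -mulrA; apply: Rintegral_itv_le => [|t tpi|t tpi]; first exact: pi_ge0.
    by apply: derivableB; exact: scaled_arc_derivable.
  rewrite -Re_opp -Re_add; apply: (le_trans (Re_le_normc _)).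
  apply: (le_trans (scaled_kern_lipschitz _ _ _ _ _ _ _)) => //.
  rewrite -/C1 -/Z mulr0 expR0 mulr1 mul1r.
  have -> : expR 1 * C1 * Z = expR 1 * (Z * C1) by ring.
  by apply: ler_wpM2r; [rewrite mulr_ge0|rewrite ler_expR cos_le1].
rewrite /Ja /Jb -RintegralB//; [|exact: scaled_ray_integrable..].
have hd s : derivable (fun s => Im (scaled_kern tau del a s pi) -
    Im (scaled_kern tau del b s pi)) s 1.
  by apply: derivableB; exact: scaled_ray_derivable.
have hb s : 0 <= s -> `|Im (scaled_kern tau del a s pi) -
    Im (scaled_kern tau del b s pi)| <= k.+3`!%:R * C1 * Z * expR (- s).
  move=> s0; rewrite -Im_opp -Im_add; apply: (le_trans (Im_le_normc _)).
  apply: (le_trans (scaled_kern_lipschitz _ _ _ _ _ _ _)) => //.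
    by rewrite pi_ge0 lexx.
  rewrite -/C1 -/Z cospi mulrN1 -expRD.
  have -> : k.+3`!%:R * C1 * Z * expR (- s) = (k.+3`!%:R * expR (- s)) * (Z * C1).
    by ring.
  apply: ler_wpM2r; first by rewrite mulr_ge0.
  by rewrite [X in expR X <= _]addrC; exact: expR_exp_bound.
have [_] := dominated_ray hd hb.
by rewrite oppr0 expR0 mulr1.
Qed.

End LipschitzInTheOrder.
End OrderDependence.

(** * Monotonicity from an expansion with Lipschitz remainder *)

Section Monotone.
Context {R : realType}.

(** A chain of steps of length e joins x to y. *)
Lemma local_to_global (lo hi e : R) (M : R -> R) : 0 < e ->
  (forall x y, lo <= x -> x < y -> y <= hi -> y - x <= e -> M x < M y) ->
  forall x y, lo <= x -> x < y -> y <= hi -> M x < M y.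
Proof.
move=> e0 loc x y lox xy yhi.
suff h (n : nat) : forall x, lo <= x -> x < y -> y - x <= n%:R * e -> M x < M y.
  apply: (h (Num.bound `|(y - x) / e|)) => //.
  rewrite -ler_pdivrMr// (le_trans (ler_norm _))// ltW//; exact: archi_boundP.
elim: n => [z loz zy|n IH z loz zy].
  by rewrite mul0r subr_le0 leNgt zy.
rewrite -natr1 mulrDl mul1r => zn.
have [ze|ze] := leP (y - z) e; first exact: loc.
apply: (@lt_trans _ _ (M (z + e))).
  by apply: loc => //; lra.
by apply: IH; lra.
Qed.

Lemma onem_expRN_ge (u : R) : 0 <= u <= 1 -> u / 2 <= 1 - expR (- u).
Proof.
move=> /andP[u0 u1]; have e := expR_ge1Dx u.
have h : expR (- u) <= (1 + u)^-1.
  by rewrite expRN lef_pV2 ?posrE ?expR_gt0//; lra.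
apply: (@le_trans _ _ (1 - (1 + u)^-1)); last by lra.
have d0 : 0 < 1 + u by lra.
have -> : 1 - (1 + u)^-1 = u / (1 + u) by field; lra.
by rewrite ler_wpM2l// lef_pV2 ?posrE//; lra.
Qed.

(** For neighbouring orders the exponential makes the leading term move at rate
    at least (delta m tau / 2) e^(-m x tau), which beats both the rate K of its
    coefficient, lacking the factor tau, and the remainder, smaller by a factor
    e^(-x tau).  Orders at distance more than 1 / (m tau) are joined by a chain,
    because there the increment of the exponential is no longer proportional to
    the distance. *)
Lemma leading_term_increasing (lo hi delta K C : R) (m : nat) (s : R -> R) :
  0 < lo -> lo <= 1 -> 0 < delta -> 0 <= K -> 0 <= C -> (0 < m)%N ->
  (forall x, lo <= x <= hi -> delta <= s x) ->
  (forall x y, lo <= x -> x <= y -> y <= hi -> `|s x - s y| <= K * (y - x)) ->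
  forall (tau : R) (r : R -> R), 2 * (K + C / lo) / delta + 1 <= tau ->
  (forall x y, lo <= x -> x <= y -> y <= hi ->
    `|r x - r y| <= C * ((y - x) * (1 + tau) * expR (- (x * m.+1%:R * tau)))) ->
  forall x y, lo <= x -> x < y -> y <= hi ->
  r x - s x * expR (- (x * m%:R * tau)) < r y - s y * expR (- (y * m%:R * tau)).
Proof.
move=> lo0 lo1 del0 K0 C0 m0 sdel slip tau r tauT rlip.
have Clo : 0 <= C / lo by rewrite divr_ge0// ltW.
have tau1 : 1 <= tau.
  by apply: le_trans tauT; rewrite lerDr divr_ge0 ?(ltW del0)// mulr_ge0// addr_ge0.
have tau0 : 0 < tau by lra.
have m1 : 1 <= m%:R :> R by rewrite ler1n.
have mt0 : 0 < m%:R * tau by rewrite mulr_gt0// ltr0n.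
apply: (@local_to_global lo hi (m%:R * tau)^-1); first by rewrite invr_gt0.
move=> x y lox xy yhi yx.
have xyI : 0 < y - x by rewrite subr_gt0.
pose u := m%:R * tau * (y - x).
have u01 : 0 <= u <= 1.
  rewrite /u mulr_ge0 ?(ltW mt0) ?(ltW xyI)//=.
  by rewrite -[leRHS](mulfV (lt0r_neq0 mt0)) ler_wpM2l// ltW.
set X := expR (- (x * m%:R * tau)).
have X0 : 0 < X by exact: expR_gt0.
have YE : expR (- (y * m%:R * tau)) = X * expR (- u).
  by rewrite /X -expRD; congr expR; rewrite /u; ring.
have rb : `|r x - r y| <= C / lo * ((y - x) * X).
  apply: (le_trans (rlip x y lox (ltW xy) yhi)).
  have -> : expR (- (x * m.+1%:R * tau)) = X * expR (- (x * tau)).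
    by rewrite /X -expRD; congr expR; rewrite -natr1; ring.
  have e1 : (1 + tau) * expR (- (x * tau)) <= lo^-1.
    have lt0 : 0 < 1 + lo * tau by rewrite addr_gt0// mulr_gt0.
    have : expR (- (x * tau)) <= (1 + lo * tau)^-1.
      rewrite expRN lef_pV2 ?posrE ?expR_gt0//.
      apply: (le_trans (expR_ge1Dx _)); rewrite ler_expR ler_wpM2r// ltW//.
    move=> h; apply: (@le_trans _ _ ((1 + tau) * (1 + lo * tau)^-1)).
      by rewrite ler_wpM2l// addr_ge0// ltW.
    rewrite ler_pdivrMr// mulrDr mulr1 mulrA mulVf ?gt_eqF// mul1r lerD2r.
    by rewrite invf_ge1.
  have -> : C * ((y - x) * (1 + tau) * (X * expR (- (x * tau)))) =
    (C * ((y - x) * X)) * ((1 + tau) * expR (- (x * tau))) by ring.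
  have -> : C / lo * ((y - x) * X) = (C * ((y - x) * X)) * lo^-1 by ring.
  rewrite ler_wpM2l// mulr_ge0// mulr_ge0 ?ltW//.
have sb := slip x y lox (ltW xy) yhi.
have sy : delta <= s y by apply: sdel; rewrite yhi (le_trans lox)// ltW.
rewrite YE -subr_gt0.
have -> : r y - s y * (X * expR (- u)) - (r x - s x * X) =
  X * (s y * (1 - expR (- u))) + X * (s x - s y) - (r x - r y) by ring.
have h1 : delta * (u / 2) <= s y * (1 - expR (- u)).
  have /andP[u0 _] := u01.
  rewrite ler_pM// ?(ltW del0) ?divr_ge0//.
  exact: onem_expRN_ge.
have h2 : - (K * (y - x)) <= s x - s y by move: sb; rewrite ler_norml => /andP[].
have h3 : r x - r y <= C / lo * ((y - x) * X) by exact: le_trans (ler_norm _) rb.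
have h1' := ler_wpM2l (ltW X0) h1.
have h2' := ler_wpM2l (ltW X0) h2.
have key : K + C / lo < delta * (tau / 2).
  have h : 2 * (K + C / lo) / delta < tau by lra.
  move: h; rewrite ltr_pdivrMr// => h.
  have -> : delta * (tau / 2) = tau * delta / 2 by ring.
  by lra.
have yX0 : 0 < (y - x) * X by rewrite mulr_gt0.
have h4 : (K + C / lo) * ((y - x) * X) < delta * (tau / 2) * ((y - x) * X).
  by rewrite ltr_pM2r.
have h5 : delta * (tau / 2) * ((y - x) * X) <= X * (delta * (u / 2)).
  have -> : X * (delta * (u / 2)) = m%:R * (delta * (tau / 2) * ((y - x) * X)).
    by rewrite /u; ring.
  by rewrite ler_peMl// mulr_ge0 ?(ltW yX0)// mulr_ge0 ?(ltW del0)// divr_ge0// ltW.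
have e : X * - (K * (y - x)) = - (K * ((y - x) * X)) by ring.
have e' : (K + C / lo) * ((y - x) * X) = K * ((y - x) * X) + C / lo * ((y - x) * X).
  by ring.
lra.
Qed.

End Monotone.

(** * Summation over the spectrum *)

Section SpectralSums.
Context {R : realType}.

Lemma dominated_series_cvg (b u : nat -> R) (B K : R) : 0 <= K ->
  (forall p, \sum_(0 <= n < p) b n <= B) -> (forall n, `|u n| <= K * b n) ->
  exists l : R, (\sum_(0 <= n < p) u n) @[p --> \oo] --> l /\ `|l| <= K * B.
Proof.
move=> K0 bB ub.
have nB p : \sum_(0 <= n < p) `|u n| <= K * B.
  apply: (@le_trans _ _ (K * \sum_(0 <= n < p) b n)); last by rewrite ler_wpM2l.
  by rewrite big_distrr/=; apply: ler_sum => n _.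
have cn : cvgn [normed series u].
  apply: nondecreasing_is_cvgn.
    by apply: nondecreasing_series => n _ _; exact: normr_ge0.
  by exists (K * B) => _ [p _ <-]; exact: nB.
have /cvg_ex[/= l ul] := normed_cvg cn.
exists l; split; first exact: ul.
apply: (cvgr_to_le (cvg_norm ul)); apply: nearW => p.
apply: le_trans (nB p); exact: ler_norm_sum.
Qed.

Variables (N : set nat) (lambda a : nat -> R).

(** Extending a by 0 and lambda by 1 outside N makes every spectral sum a sum
    over all of nat, with positive eigenvalues throughout. *)
Definition spectral_coef (n : nat) : R := if n \in N then a n else 0.
Definition spectral_value (n : nat) : R := if n \in N then lambda n else 1.

Lemma spectral_sumE (f : R -> R) (p : nat) :
  \sum_(0 <= n < p | n \in N) (a n * f (lambda n)) =
  \sum_(0 <= n < p) (spectral_coef n * f (spectral_value n)).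
Proof.
rewrite big_mkcond/=; apply: eq_bigr => n _.
by rewrite /spectral_coef /spectral_value; case: ifP => // _; rewrite mul0r.
Qed.

Hypothesis summable_a : summable N (fun n => (a n / lambda n)%:E).

Let b n := `|spectral_coef n| / `|spectral_value n|.

Lemma summable_partial : exists B : R, 0 <= B /\
  forall p, \sum_(0 <= n < p) b n <= B.
Proof.
have h := summable_a; rewrite /summable in h.
have e0 : forall n, (n \in N -> 0 <= `|(a n / lambda n)%:E|)%E by move=> n _.
have := @nneseries_esum R (fun n => `|(a n / lambda n)%:E|)%E (fun n => n \in N) e0.
rewrite [X in (_ = esum X _)%E -> _](_ : _ = N); last by rewrite set_mem_set.
move=> E.
have s0 : (0 <= \sum_(i <oo | i \in N) `|(a i / lambda i)%:E|)%E.
  by apply: nneseries_ge0 => n _ _.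
have fin : (\sum_(i <oo | i \in N) `|(a i / lambda i)%:E|)%E \is a fin_num.
  by rewrite ge0_fin_numE// E.
exists (fine (\sum_(i <oo | i \in N) `|(a i / lambda i)%:E|)%E).
split; first exact: fine_ge0.
move=> p; rewrite -lee_fin fineK//.
have := @nneseries_lim_ge R (fun n => `|(a n / lambda n)%:E|)%E (fun n => n \in N) 0 p.
move=> /(_ (fun n _ _ => abse_ge0 _)) h2.
apply: le_trans h2.
rewrite (_ : (\sum_(0 <= i < p | i \in N) `|(a i / lambda i)%:E|)%E =
  (\sum_(0 <= i < p | i \in N) `|a i / lambda i|)%:E); last by rewrite -sumEFin.
rewrite lee_fin [leRHS]big_mkcond/=; apply: ler_sum => n _.
rewrite /b /spectral_coef /spectral_value; case: ifP => [nN|_].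
  by rewrite /= normrM normfV.
by rewrite normr0 mul0r.
Qed.

End SpectralSums.

Section ObservationExpansion.
Context {R : realType}.
Variables (N : set nat) (lambda a : nat -> R) (l0 : R).
Hypotheses (summable_a : summable N (fun n => (a n / lambda n)%:E))
  (l00 : 0 < l0) (lambda_ge : forall n, N n -> l0 <= lambda n) (l01 : l0 <= 1).

Local Notation coef := (spectral_coef N a).
Local Notation value := (spectral_value N lambda).

Lemma value_ge n : l0 <= value n.
Proof.
rewrite /spectral_value; case: ifP => // nN; apply: lambda_ge.
by rewrite inE in nN.
Qed.

Lemma value_gt0 n : 0 < value n. Proof. exact: lt_le_trans (value_ge n). Qed.

Lemma valueV_le n : (value n)^-1 <= l0^-1.
Proof. by rewrite lef_pV2 ?posrE ?value_gt0// value_ge. Qed.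

Lemma spectral_ratio_le (k n : nat) :
  `|coef n / value n ^+ k.+1| <= l0^-1 ^+ k * (`|coef n| / `|value n|).
Proof.
have -> : `|coef n / value n ^+ k.+1| =
    `|value n|^-1 ^+ k * (`|coef n| / `|value n|).
  by rewrite normrM normfV normrX exprS invfM exprVn; ring.
apply: ler_wpM2r; first by rewrite divr_ge0.
rewrite lerXn2r ?nnegrE ?invr_ge0 ?(ltW l00)//.
by rewrite (gtr0_norm (value_gt0 n)) valueV_le.
Qed.

Lemma moment_cvg (k : nat) : (0 < k)%N ->
  \sum_(0 <= n < p) coef n / value n ^+ k @[p --> \oo] -->
  resolvent_moment N lambda a k.
Proof.
case: k => // k _.
have [B [B0 hB]] := summable_partial summable_a.
have K0 : 0 <= l0^-1 ^+ k by rewrite exprn_ge0// invr_ge0 ltW.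
have [l [hl _]] := dominated_series_cvg K0 hB (spectral_ratio_le k).
suff -> : resolvent_moment N lambda a k.+1 = l by [].
apply/cvg_lim => //.
have -> : (fun p : nat => \sum_(0 <= n < p | n \in N) a n / lambda n ^+ k.+1) =
    (fun p => \sum_(0 <= n < p) coef n / value n ^+ k.+1).
  apply/funext => p.
  exact: (spectral_sumE N lambda a (fun x => (x ^+ k.+1)^-1)).
exact: hl.
Qed.

Lemma expR_powR (tau al : R) : expR tau `^ al = expR (al * tau).
Proof. by rewrite -expRM mulrC. Qed.

Definition remainder_term (m : nat) (tau al : R) (n : nat) : R :=
  coef n / value n ^+ m.+1 * scaled_hankel m.+1 tau (value n)^-1 al.

Lemma observation_term (m : nat) (tau al : R) (n : nat) : 0 < al < 1 ->
  coef n * mittag_leffler al 1 (- value n * expR tau `^ al) =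
  \sum_(1 <= k < m.+1) ((-1) ^+ k.+1 * hankel_pow (k%:R * al) *
    expR (- (al * k%:R * tau)) * (coef n / value n ^+ k)) +
  (-1) ^+ m * remainder_term m tau al n.
Proof.
move=> /andP[al0 al1]; rewrite expR_powR mulNr.
have x0 : 0 < value n * expR (al * tau) by rewrite mulr_gt0 ?value_gt0 ?expR_gt0.
have eE (k : nat) : (value n * expR (al * tau))^-1 ^+ k =
    expR (- (al * k%:R * tau)) / value n ^+ k.
  rewrite invfM exprMn exprVn mulrC -expRN -expRM_natr; congr (expR _ / _); ring.
rewrite (mittag_leffler_expand al0 al1 x0 m) mulrDr; congr (_ + _).
  by rewrite big_distrr/=; apply: eq_bigr => k _; rewrite eE; ring.
rewrite /remainder_term /scaled_hankel eE.
have -> : (value n * expR (al * tau))^-1 = (value n)^-1 * expR (- (al * tau)).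
  by rewrite invfM expRN.
by ring.
Qed.

Variable m : nat.
Hypotheses (m0 : (0 < m)%N)
  (S_eq0 : forall k, (1 <= k < m)%N -> resolvent_moment N lambda a k = 0).

Variable al1 : R.
Hypotheses (al10 : 0 <= al1) (al11 : al1 < 1).

Lemma remainder_cvg (tau al : R) : 0 < al -> al <= al1 -> exists l : R,
  \sum_(0 <= n < p) remainder_term m tau al n @[p --> \oo] --> l.
Proof.
move=> a0 aa1.
have [B [B0 hB]] := summable_partial summable_a.
have [C hC] : exists C : R, forall h, 0 <= h ->
    `|hankel (m.+1%:R * al) h al 0| <= C.
  by eexists => h h0; exact: (hankel_bounded m.+1 al10 al11 (ltW a0) aa1 h0).
have C0 : 0 <= C by apply: le_trans (hC 0 (lexx _)).
pose K := l0^-1 ^+ m * (expR (- (al * m.+1%:R * tau)) * C).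
have K0 : 0 <= K by rewrite !mulr_ge0 ?exprn_ge0 ?invr_ge0 ?expR_ge0// ltW.
have tK n : `|remainder_term m tau al n| <= K * (`|coef n| / `|value n|).
  rewrite /remainder_term normrM /K mulrAC ler_pM//; first exact: spectral_ratio_le.
  rewrite /scaled_hankel normrM ger0_norm ?expR_ge0// ler_wpM2l ?expR_ge0//.
  by apply: hC; rewrite mulr_ge0 ?expR_ge0// invr_ge0 ltW// value_gt0.
have [l [hl _]] := dominated_series_cvg K0 hB tK.
by exists l.
Qed.

Definition remainder (tau al : R) : R :=
  (-1) ^+ m * lim (\sum_(0 <= n < p) remainder_term m tau al n @[p --> \oo]).

Lemma observation_expand (tau al : R) : 0 < al -> al <= al1 ->
  observation N lambda a al (expR tau) =
  remainder tau al +
  resolvent_moment N lambda a m * lead_coeff m al * expR (- (al * m%:R * tau)).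
Proof.
move=> a0 aa1; have a01 : 0 < al < 1 by rewrite a0 (le_lt_trans aa1).
have [l hl] := remainder_cvg tau a0 aa1.
rewrite /remainder (cvg_lim (@norm_hausdorff _ _) hl).
pose term k := (-1) ^+ k.+1 * hankel_pow (k%:R * al) * expR (- (al * k%:R * tau)).
have partial p : \sum_(0 <= n < p | n \in N)
    (a n * mittag_leffler al 1 (- lambda n * expR tau `^ al)) =
    \sum_(1 <= k < m.+1) term k * \sum_(0 <= n < p) coef n / value n ^+ k +
    (-1) ^+ m * \sum_(0 <= n < p) remainder_term m tau al n.
  rewrite (spectral_sumE N lambda a (fun x => mittag_leffler al 1 (- x * expR tau `^ al))).
  under eq_bigr do rewrite (observation_term m tau _ a01).
  rewrite big_split/= -big_distrr/= exchange_big/=; congr (_ + _).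
  by apply: eq_bigr => k _; rewrite big_distrr.
rewrite /observation; apply/cvg_lim => //.
under eq_fun do rewrite partial.
rewrite addrC; apply: cvgD; last by apply: cvgMr.
have -> : resolvent_moment N lambda a m * lead_coeff m al *
    expR (- (al * m%:R * tau)) =
    \sum_(1 <= k < m.+1) term k * resolvent_moment N lambda a k.
  rewrite big_nat_recr//= big_nat big1 => [|k km]; last by rewrite S_eq0 ?mulr0.
  by rewrite add0r /term /lead_coeff rGammaE subKr; ring.
have -> : (fun p : nat => \sum_(1 <= k < m.+1) term k *
      (\sum_(0 <= n < p) coef n / value n ^+ k)) =
    (fun p : nat => \sum_(1 <= k < m.+1 | (0 < k)%N) term k *
      (\sum_(0 <= n < p) coef n / value n ^+ k)).
  apply/funext => p; rewrite [LHS]big_nat [RHS]big_nat_cond.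
  by apply: eq_bigl => k; case: k => [|k]; rewrite ?andbT.
have -> : \sum_(1 <= k < m.+1) term k * resolvent_moment N lambda a k =
    \sum_(1 <= k < m.+1 | (0 < k)%N) term k * resolvent_moment N lambda a k.
  rewrite [LHS]big_nat [RHS]big_nat_cond.
  by apply: eq_bigl => k; case: k => [|k]; rewrite ?andbT.
apply: cvg_big => [|k k0].
  exact: add_continuous.
by apply: cvgMr; exact: moment_cvg.
Qed.

Lemma remainder_lipschitz : exists C : R, 0 <= C /\ forall tau x y, 0 <= tau ->
  0 < x -> x <= y -> y <= al1 -> `|remainder tau x - remainder tau y| <=
  C * ((y - x) * (1 + tau) * expR (- (x * m.+1%:R * tau))).
Proof.
have [B [B0 hB]] := summable_partial summable_a.
have d0 : 0 <= l0^-1 by rewrite invr_ge0 ltW.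
have [C [C0 hC]] := scaled_hankel_lipschitz m.+1 al10 al11 d0.
exists (l0^-1 ^+ m * C * B); split; first by rewrite !mulr_ge0 ?exprn_ge0.
move=> tau x y tau0 x0 xy y1.
have y0 : 0 < y by exact: lt_le_trans xy.
have [lx hx] := remainder_cvg tau x0 (le_trans xy y1).
have [ly hy] := remainder_cvg tau y0 y1.
rewrite /remainder (cvg_lim (@norm_hausdorff _ _) hx) (cvg_lim (@norm_hausdorff _ _) hy).
rewrite -mulrBr normrM normrX normrN1 expr1n mul1r.
set Z := (y - x) * _ * _.
have Z0 : 0 <= Z.
  apply: mulr_ge0; last exact: expR_ge0.
  by apply: mulr_ge0; rewrite ?subr_ge0 ?addr_ge0.
pose K := l0^-1 ^+ m * (C * Z).
have K0 : 0 <= K by apply: mulr_ge0; [exact: exprn_ge0|exact: mulr_ge0].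
have tK n : `|remainder_term m tau x n - remainder_term m tau y n| <=
    K * (`|coef n| / `|value n|).
  rewrite /remainder_term -mulrBr normrM /K mulrAC ler_pM//.
    exact: spectral_ratio_le.
  apply: hC => //; last exact: ltW.
  by rewrite invr_ge0 (ltW (value_gt0 n)) valueV_le.
have [l [hl lB]] := dominated_series_cvg K0 hB tK.
have -> : lx - ly = l.
  apply: (cvg_unique _ _ hl) => //.
  have -> : (fun p : nat => \sum_(0 <= n < p)
      (remainder_term m tau x n - remainder_term m tau y n)) =
    (fun p : nat => \sum_(0 <= n < p) remainder_term m tau x n -
      \sum_(0 <= n < p) remainder_term m tau y n).
    by apply/funext => p; rewrite sumrB.
  by apply: cvgB.
have -> : l0^-1 ^+ m * C * B * Z = K * B by rewrite /K; ring.
exact: lB.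
Qed.

Lemma lead_coeff_lipschitz : exists K : R, 0 <= K /\ forall x y, 0 <= x ->
  x <= y -> y <= al1 ->
  `|lead_coeff m x - lead_coeff m y| <= K * (y - x).
Proof.
have [C [C0 hC]] := scaled_hankel_lipschitz m al10 al11 (lexx 0).
exists C; split => // x y x0 xy y1.
rewrite /lead_coeff -mulrBr normrM normrX normrN1 expr1n mul1r.
have E z : rGamma (1 - m%:R * z) = scaled_hankel m 0 0 z.
  by rewrite rGammaE subKr /scaled_hankel mul0r mulr0 oppr0 expR0 mul1r hankel_powE.
rewrite !E; apply: le_trans (hC _ _ _ _ _ _ _ _ _) _; rewrite ?lexx//.
by rewrite mulr0 oppr0 expR0 addr0 !mulr1.
Qed.

End ObservationExpansion.

(** * Sign and zeros of the leading coefficient *)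

Section SignAndZeros.
Context {R : realType}.

(** The Lipschitz range is larger than [a, b] on both sides, so that the function
    is continuous at the end points in the ordinary sense. *)
Lemma lipschitz_within_continuous (f : R -> R) (lo hi K : R) :
  (forall x y, lo <= x -> x <= y -> y <= hi -> `|f x - f y| <= K * (y - x)) ->
  forall a b, lo < a -> b < hi -> {within `[a, b], continuous f}.
Proof.
move=> lip a b loa bhi; apply: continuous_in_subspaceT => x.
rewrite inE/= in_itv/= => /andP[ax xb].
have lox : lo < x by exact: lt_le_trans ax.
have xhi : x < hi by exact: le_lt_trans bhi.
apply/cvgrPdist_le => e e0.
have r0 : 0 < (`|K| + 1)^-1 * e by rewrite mulr_gt0 ?invr_gt0 ?ltr_wpDl.
near=> y.
have loy : lo <= y by near: y; apply: filterS (lt_nbhsr lox) => z /ltW.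
have yhi : y <= hi by near: y; apply: filterS (lt_nbhsl xhi) => z /ltW.
apply: (@le_trans _ _ (`|K| * `|x - y|)).
  have [xy|/ltW yx] := leP x y.
    rewrite (le_trans (lip _ _ (ltW lox) xy yhi))// distrC (ger0_norm (x := y - x)) ?subr_ge0//.
    by rewrite ler_wpM2r ?subr_ge0// ler_norm.
  rewrite distrC (le_trans (lip _ _ loy yx (ltW xhi)))// (ger0_norm (x := x - y)) ?subr_ge0//.
  by rewrite ler_wpM2r ?subr_ge0// ler_norm.
apply: (@le_trans _ _ ((`|K| + 1) * `|x - y|)).
  by rewrite ler_wpM2r// lerDl.
rewrite -ler_pdivlMl ?ltr_wpDl//.
Unshelve. all: by end_near. Qed.

Lemma constant_sign (f : R -> R) (a b : R) : a <= b ->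
  {within `[a, b], continuous f} -> (forall x, x \in `[a, b] -> f x != 0) ->
  {in `[a, b], forall x, 0 < f x} \/ {in `[a, b], forall x, f x < 0}.
Proof.
move=> ab cf f0.
have cf' x : x \in `[a, b] -> {within `[a, x], continuous f}.
  rewrite in_itv/= => /andP[ax xb]; apply: continuous_subspaceW cf.
  by apply: subset_itv; rewrite bnd_simp.
have sub x y : x \in `[a, b] -> y \in `[a, x] -> y \in `[a, b].
  rewrite !in_itv/= => /andP[ax xb] /andP[ay yx].
  by rewrite ay (le_trans yx xb).
have aI : a \in `[a, b] by rewrite in_itv/= lexx.
have [fa|fa|fa] := ltgtP (f a) 0; last by have := f0 a aI; rewrite fa eqxx.
- right=> x xI; rewrite ltNge; apply/negP => fx.
  have ax : a <= x by move: xI; rewrite in_itv/= => /andP[].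
  have [|c cI fc] := @IVT R f a x 0 ax (cf' x xI).
    by rewrite ge_min le_max (ltW fa) fx orbT.
  by have := f0 c (sub x c xI cI); rewrite fc eqxx.
- left=> x xI; rewrite ltNge; apply/negP => fx.
  have ax : a <= x by move: xI; rewrite in_itv/= => /andP[].
  have [|c cI fc] := @IVT R f a x 0 ax (cf' x xI).
    by rewrite ge_min le_max (ltW fa) fx orbT.
  by have := f0 c (sub x c xI cI); rewrite fc eqxx.
Qed.

Lemma lead_coeff_eq0 (m : nat) (al : R) :
  lead_coeff m al = 0 <-> exists i : nat, m%:R * al = i.+1%:R.
Proof.
have -> : lead_coeff m al = 0 <-> rGamma (1 - m%:R * al) = 0.
  split=> [/eqP|E]; last by rewrite /lead_coeff E mulr0.
  by rewrite mulf_eq0 signr_eq0 => /eqP.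
rewrite rGamma_eq0; split=> -[i h]; exists i; first by rewrite -natr1; lra.
by rewrite h -natr1; ring.
Qed.

End SignAndZeros.

(** * Monotonicity of the observation in the order *)

Theorem theorem4p2 (R : realType) (H : completeNormedModType R)
    (ip : {dot H for idfun}) (dom : set H) (A : H -> H)
    (N : set nat) (lambda : nat -> R) (v : nat -> H) (a : nat -> R)
    (alpha0 alpha1 : R) (m : nat)
    (hilbertH : hilbert_inner_product ip)
    (separableH : separable_space H)
    (linA : linear_on dom A)
    (saA : self_adjoint ip dom A)
    (posA : strictly_positive ip dom A)
    (crA : compact_resolvent dom A)
    (basisA : eigenbasis ip dom A N lambda v)
    (summable_a : summable N (fun n => (a n / lambda n)%:E))
    (alpha0_gt0 : 0 < alpha0) (alpha01 : alpha0 <= alpha1)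
    (alpha1_lt1 : alpha1 < 1)
    (m_gt0 : (0 < m)%N)
    (S_eq0 : forall k, (1 <= k < m)%N -> resolvent_moment N lambda a k = 0)
    (S_neq0 : resolvent_moment N lambda a m != 0) :
  let I := `[alpha0, alpha1] in
  let M := fun t alpha => observation N lambda a alpha t in
  let s := fun alpha => - resolvent_moment N lambda a m * lead_coeff m alpha in
  ((1 < m)%N ->
     (forall alpha, alpha \in I -> lead_coeff m alpha != 0) <->
     (forall j, (1 <= j <= m - 1)%N -> j%:R / m%:R \notin I)) /\
  ((forall alpha, alpha \in I -> lead_coeff m alpha != 0) ->
     ({in I, forall alpha, 0 < s alpha} \/ {in I, forall alpha, s alpha < 0}) /\
     exists T : R, 1 < T /\
       forall t0, T <= t0 ->
         [/\ {in I &, {homo M t0 : x y / x < y}} \/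
               {in I &, {homo M t0 : x y /~ x < y}},
             {in I, forall alpha, 0 < s alpha} ->
               {in I &, {homo M t0 : x y / x < y}},
             {in I, forall alpha, s alpha < 0} ->
               {in I &, {homo M t0 : x y /~ x < y}}
           & forall d0 : R,
               is_subset1 [set alpha | alpha \in I /\ M t0 alpha = d0]]).
Proof.
move=> I M s.
have alI x : x \in I -> alpha0 <= x <= alpha1 by rewrite in_itv.
split.
  move=> m1; have m0 : (0 : R) < m%:R by rewrite ltr0n.
  split=> [c0 j /andP[j1 jm]|jI al alin].
    apply/negP => jI; have /eqP := c0 _ jI; apply.
    apply/lead_coeff_eq0; exists j.-1.
    by rewrite prednK// mulrCA divff ?mulr1// gt_eqF.
  apply/eqP => /lead_coeff_eq0[i mi].
  have /andP[_ al1] := alI _ alin.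
  have im : (i.+1 < m)%N.
    rewrite -(ltr_nat R) -mi -[ltRHS]mulr1 ltr_pM2l//.
    exact: le_lt_trans alpha1_lt1.
  have : (1 <= i.+1 <= m - 1)%N by rewrite leq_subRL ?add1n// ltnW.
  move=> /jI; rewrite -mi mulrAC divff ?gt_eqF// mul1r.
  by rewrite alin.
move=> c_neq0.
(* an order between alpha1 and 1: room to the right for the continuity of s *)
pose be : R := (1 + alpha1) / 2.
have a1be : alpha1 < be by rewrite /be; lra.
have be1 : be < 1 by rewrite /be; lra.
have be0 : 0 <= be by lra.
have a10 : 0 <= alpha1 by lra.
have [l0 [l00 l01 lge]] : exists l0 : R,
    [/\ 0 < l0, l0 <= 1 & forall n, N n -> l0 <= lambda n].
  have [N0|N0] := pselect (N 0).
    (* at most 1, because the eigenvalue list is extended by 1 outside N *)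
    exists (Num.min (lambda 0) 1); split.
    - by rewrite lt_min (eigenbasis_gt0 basisA N0) ltr01.
    - by rewrite ge_min lexx orbT.
    - by move=> n Nn; rewrite ge_min (eigenbasis_le basisA N0 Nn).
  exists 1; split => // n Nn; exfalso; apply: N0.
  case: (eigenbasis_index basisA) => [->//|[d NE]].
  by move: Nn; rewrite NE /=; exact: leq_ltn_trans.
have [K1 [K10 slip1]] := lead_coeff_lipschitz m be0 be1.
have [C [C0 rlip]] := remainder_lipschitz summable_a l00 lge l01 m a10 alpha1_lt1.
have Mexp tau al : al \in I -> M (expR tau) al =
    remainder N lambda a m tau al - s al * expR (- (al * m%:R * tau)).
  move=> /alI/andP[a0al ala1].
  rewrite /M (observation_expand summable_a l00 lge l01 m_gt0 S_eq0 a10 alpha1_lt1)//.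
    by rewrite /s !mulNr opprK.
  exact: lt_le_trans a0al.
pose S := resolvent_moment N lambda a m.
have slip x y : 0 <= x -> x <= y -> y <= be ->
    `|s x - s y| <= `|S| * K1 * (y - x).
  move=> x0 xy ybe; rewrite /s -mulrBr normrM normrN -mulrA ler_wpM2l//.
  exact: slip1.
have s_neq0 x : x \in I -> s x != 0.
  by move=> xI; rewrite /s mulf_neq0 ?oppr_eq0 ?c_neq0.
have scont := lipschitz_within_continuous slip alpha0_gt0 a1be.
have sign := constant_sign alpha01 scont s_neq0.
have a0I : alpha0 \in I by rewrite in_itv/= lexx.
split; first exact: sign.
(* multiplying by the constant sign sg of s leaves only the increasing case *)
have [sg [sg1 sgs]] : exists sg : R, `|sg| = 1 /\ forall x, x \in I -> 0 < sg * s x.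
  case: sign => h; [exists 1|exists (-1)]; rewrite ?normrN1 ?normr1; split => // x xI.
    by rewrite mul1r h.
  by rewrite mulN1r oppr_gt0 h.
have [delta [delta0 sdel]] : exists delta : R,
    0 < delta /\ forall x, alpha0 <= x <= alpha1 -> delta <= sg * s x.
  have cc : {within `[alpha0, alpha1], continuous (fun x => sg * s x)}.
    apply: (@lipschitz_within_continuous _ _ 0 be (`|S| * K1)) => // x y x0 xy yb.
    by rewrite -mulrBr normrM sg1 mul1r slip.
  have [c cI hc] := EVT_min alpha01 cc.
  exists (sg * s c); split; first exact: sgs.
  by move=> x xI; apply: hc; rewrite in_itv.
pose K := `|S| * K1.
have K0 : 0 <= K by rewrite mulr_ge0.
pose tau0 := 2 * (K + C / alpha0) / delta + 1.
have tau00 : 0 < tau0.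
  rewrite ltr_wpDl// divr_ge0 ?(ltW delta0)// mulr_ge0// addr_ge0//.
  by rewrite divr_ge0// ltW.
exists (expR tau0); split; first by rewrite expR_gt1.
move=> t0 Tt0.
have t00 : 0 < t0 by exact: lt_le_trans (expR_gt0 _) Tt0.
have tau0le : tau0 <= ln t0 by rewrite -[tau0]expRK ler_ln ?posrE ?expR_gt0.
have t0E : t0 = expR (ln t0) by rewrite lnK.
have tau_ge0 : 0 <= ln t0 by exact: le_trans (ltW tau00) tau0le.
have key x y : x \in I -> y \in I -> x < y -> sg * M t0 x < sg * M t0 y.
  move=> xI yI xy; have /andP[ax xb] := alI _ xI; have /andP[ay yb] := alI _ yI.
  have ME z : z \in I -> sg * M t0 z = sg * remainder N lambda a m (ln t0) z -
      sg * s z * expR (- (z * m%:R * ln t0)).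
    move=> zI; have := Mexp (ln t0) z zI; rewrite -t0E => ->.
    by rewrite mulrBr [X in _ - X]mulrA.
  rewrite [ltLHS](ME x xI) [ltRHS](ME y yI).
  apply: (@leading_term_increasing R alpha0 alpha1 delta K C m (fun x => sg * s x)
    alpha0_gt0 _ delta0 K0 C0 m_gt0 sdel _ (ln t0)
    (fun x => sg * remainder N lambda a m (ln t0) x)) => //.
  - by rewrite (le_trans alpha01)// ltW.
  - move=> u w au uw wa; rewrite -mulrBr normrM sg1 mul1r slip//.
      by rewrite (le_trans _ au)// ltW.
    by rewrite (le_trans wa)// ltW.
  - move=> u w au uw wa; rewrite -mulrBr normrM sg1 mul1r rlip//.
    exact: lt_le_trans au.
have pos_incr : {in I, forall al, 0 < s al} -> {in I &, {homo M t0 : x y / x < y}}.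
  move=> sp x y xI yI xy.
  have sg0 : 0 < sg by have := sgs _ a0I; rewrite pmulr_lgt0// sp.
  by have := key x y xI yI xy; rewrite ltr_pM2l.
have neg_decr : {in I, forall al, s al < 0} -> {in I &, {homo M t0 : x y /~ x < y}}.
  move=> sn x y xI yI yx.
  have sg0 : sg < 0 by have := sgs _ a0I; rewrite nmulr_lgt0// sn.
  by have := key y x yI xI yx; rewrite ltr_nM2l.
split=> //.
- by case: sign => h; [left; exact: pos_incr|right; exact: neg_decr].
- move=> d0 x y [xI xd] [yI yd]; case: (ltgtP x y) => // xy.
    by have := key x y xI yI xy; rewrite xd yd ltxx.
  by have := key y x yI xI xy; rewrite xd yd ltxx.
Qed.
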